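(* For every $n\ge4$, $\mathcal{PMV}(n,2)\subseteq \mathrm{Pl}_n$. Moreover, for every $n\ge 8$ this inclusion is proper.
   Context: $\mathcal K_2$ denotes the set of nonempty compact convex subsets of $\mathbb R^2$. The mixed area of $K,L\in\mathcal K_2$ is $\mathrm V(K,L)=\tfrac12\big(\mathrm{Vol}_2(K+L)-\mathrm{Vol}_2(K)-\mathrm{Vol}_2(L)\big)$. Coordinates of $\mathbb R^{\binom n2}$ are indexed by unordered pairs $\{i,j\}\subset[n]$, written $v_{ij}=v_{ji}$. $\mathcal{PMV}(n,2)=\{(\mathrm V(K_i,K_j))_{\{i,j\}\subset[n]} : K_1,\dots,K_n\in\mathcal K_2\}$. The Plücker space is $\mathrm{Pl}_n=\{v\in\mathbb R_{\ge0}^{\binom n2} : v_{ij}v_{kl}\le v_{ik}v_{jl}+v_{il}v_{jk}\ \text{for all } i,j,k,l\in[n] \text{ with } \{i,j\}\sqcup\{k,l\}\subseteq[n]\}$ (i.e. $i,j,k,l$ pairwise distinct). *)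

(* Defs.v *)
From HB Require Import structures.
From mathcomp Require Import all_boot all_order all_algebra.
From mathcomp Require Import all_classical all_reals all_analysis.
Set Implicit Arguments. Unset Strict Implicit. Unset Printing Implicit Defensive.
Import Order.TTheory GRing.Theory Num.Theory numFieldNormedType.Exports.
Local Open Scope classical_set_scope.
Local Open Scope ring_scope.

Definition area (R : realType) (A : set (R * R)) : \bar R :=
  ((@lebesgue_measure R) \x (@lebesgue_measure R))%E A.

Definition convex2 (R : realType) (K : set (R * R)) : Prop :=
  forall x y, K x -> K y -> forall t : R, 0 <= t <= 1 ->
    K (t * x.1 + (1 - t) * y.1, t * x.2 + (1 - t) * y.2).

Definition convex_body2 (R : realType) (K : set (R * R)) : Prop :=
  K !=set0 /\ compact K /\ convex2 K.

Definition msum (R : realType) (K L : set (R * R)) : set (R * R) :=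
  [set z | exists2 x, K x & exists2 y, L y & z = (x.1 + y.1, x.2 + y.2)].

(* Mixed area V(K,L) = (Vol(K+L) - Vol K - Vol L)/2 (areas of compact sets are finite). *)
Definition mixed_area (R : realType) (K L : set (R * R)) : R :=
  (fine (area (msum K L)) - fine (area K) - fine (area L)) / 2.

(* A point of R^{binom n 2} is represented by a symmetric function v : 'I_n -> 'I_n -> R;
   only the off-diagonal values v i j (i != j), with v i j = v j i, are coordinates. *)
Definition sym_vec (R : realType) (n : nat) (v : 'I_n -> 'I_n -> R) : Prop :=
  forall i j, v i j = v j i.

Definition inPMV (R : realType) (n : nat) (v : 'I_n -> 'I_n -> R) : Prop :=
  exists K : 'I_n -> set (R * R),
    (forall i, convex_body2 (K i)) /\
    (forall i j, i != j -> v i j = mixed_area (K i) (K j)).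

Definition inPl (R : realType) (n : nat) (v : 'I_n -> 'I_n -> R) : Prop :=
  (forall i j, i != j -> 0 <= v i j) /\
  (forall i j k l : 'I_n,
      i != j -> i != k -> i != l -> j != k -> j != l -> k != l ->
      v i j * v k l <= v i k * v j l + v i l * v j k).

(* Main.v *)
(* A polygon is encoded by the list of its edge vectors.  Four times the mixed
   area of two polygons is the sum of |det (a, b)| over the pairs of edges a, b
   lying on the same side of a line through 0, whichever line is chosen.  The
   Plucker inequality is linear in K, so K may be taken to be a segment or a
   triangle.  For a segment, choosing the line parallel to it, the inequality
   holds termwise by the Plucker relation between determinants.  For a triangle,
   dividing by the values V (K, .) turns it into the triangle inequality
   V (M, N) <= V (L, M) + V (L, N); here V (M, N) is the area of K minus a
   contribution of each of the three corners of K, and what remains is the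
   polynomial inequality [cap_sum_ge0].
   A convex body is the decreasing intersection of circumscribed polygons with
   prescribed slopes.  Their edge lengths are linear in the support function,
   hence additive under Minkowski sums, and areas converge by continuity of the
   measure from above.
   For the strictness take v = 0 on the four pairs {2i, 2i+1} and v = 1 on the
   other pairs of indices below 8.  If K, L is such a pair of bodies, then
   V (K, K) V (L, M) <= 2 V (K, L) V (K, M) = 0, so K has no area and is a
   segment.  This gives four vectors whose pairwise determinants have the same
   nonzero absolute value, against the Plucker relation. *)

From HB Require Import structures.
From mathcomp Require Import all_boot all_order all_algebra.
From mathcomp Require Import all_classical all_reals all_analysis.
From mathcomp Require Import measurable_realfun.
From mathcomp Require Import ring lra zify.
Require Import Defs.
Set Implicit Arguments. Unset Strict Implicit. Unset Printing Implicit Defensive.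
Import Order.TTheory GRing.Theory Num.Theory numFieldNormedType.Exports.
Local Open Scope classical_set_scope.
Local Open Scope ring_scope.

(** * The polynomial inequality behind the triangle case *)

(** The formula for four times the mixed area polarizes one for the area. The two vertices that are
    extreme across the chosen line split the boundary into two paths, and the region between a path
    and its chord has as area half the sum of the determinants over unordered pairs of its edges.
    Independence of the line is essential: K is decomposed edge by edge under one fixed line,
    whereas the cases of a segment and of a triangle need a line along one of the edges of K. In the
    triangle case the corner terms couple all edges of L, M and N. They are decoupled by replacing L
    in each corner by its chord. This enlarges the corner terms of L with M and of L with N, which
    have to be bounded from above, and the product of the two enlarged terms bounds the corner term
    of M with N from below. Nine numbers remain: the positions of three touching points of L, and
    three relative corner terms for each of M and N. *)

Section Cap.
Variable R : realFieldType.
Implicit Types p x z : R.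

(** The two mean conditions bound [- (p1 * (1 - p2) * x1)] both by [p1 * p2] and by
    [(1 - p1) * (1 - p2)]; these two bounds are averaged with weights [p3] and [1 - p3]. *)
Lemma cap_one p1 p2 p3 x1 x2 x3 z1 :
  0 <= p1 <= 1 -> 0 <= p2 <= 1 -> 0 <= p3 <= 1 ->
  x1 <= 0 -> x2 <= 1 -> x3 <= 1 -> 0 <= z1 <= 1 ->
  0 <= p1 * x1 + (1 - p1) * x3 -> 0 <= p2 * x2 + (1 - p2) * x1 ->
  0 <= p1 * (1 - p2) * (x1 * z1) + p1 * p2 * p3 + (1 - p1) * (1 - p2) * (1 - p3).
Proof.
move=> /andP[a0 a1] /andP[b0 b1] /andP[c0 c1] hx1 hx2 hx3 /andP[z0 zle] h1 h2.
have e1 : - (p1 * x1) <= 1 - p1 by nra.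
have e2 : - ((1 - p2) * x1) <= p2 by nra.
have f1 : - (p1 * (1 - p2) * (x1 * z1)) <= - (p1 * (1 - p2) * x1).
  have : 0 <= p1 * (1 - p2) * (- x1) * (1 - z1) by rewrite !mulr_ge0 //; lra.
  nra.
have f2 : - (p1 * (1 - p2) * x1) <= (1 - p1) * (1 - p2) by nra.
have f3 : - (p1 * (1 - p2) * x1) <= p1 * p2 by nra.
nra.
Qed.

(* The left-hand side is affine in [u] and in [v]; it reaches the right-hand side at
   the vertices of the polytope of admissible [u, v], which are told apart by the
   signs of [a + b - 1] and [b + c - 1]. *)
Lemma cap_corner (a b c u v : R) :
  0 <= a <= 1 -> 0 <= b <= 1 -> 0 <= c <= 1 -> 0 <= u -> 0 <= v ->
  a * u <= 1 - a -> (1 - b) * u <= b -> b * v <= 1 - b -> (1 - c) * v <= c ->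
  a * (1 - b) * u + b * (1 - c) * v - a * (1 - c) * u * v
    <= a * b * c + (1 - a) * (1 - b) * (1 - c).
Proof.
move=> /andP[a0 a1] /andP[b0 b1] /andP[c0 c1] u0 v0 h1 h2 h3 h4.
have A0 : 0 <= 1 - a by lra.
have B0 : 0 <= 1 - b by lra.
have C0 : 0 <= 1 - c by lra.
have U : a * (1 - b) * u <= a * b * c + (1 - a) * (1 - b) * (1 - c).
  have e1 : a * (1 - b) * u <= (1 - a) * (1 - b) by nra.
  have e2 : a * (1 - b) * u <= a * b by nra.
  nra.
have V : b * (1 - c) * v <= a * b * c + (1 - a) * (1 - b) * (1 - c).
  have e1 : b * (1 - c) * v <= (1 - b) * (1 - c) by nra.
  have e2 : b * (1 - c) * v <= b * c by nra.
  nra.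
have [lab|lab] := leP (1 - a) b.
  have [l|l] := leP (1 - b) ((1 - c) * v).
    have : 0 <= a * u * ((1 - c) * v - (1 - b)) by rewrite !mulr_ge0 //; lra.
    lra.
  have : a * u * (1 - b - (1 - c) * v) <= (1 - a) * (1 - b - (1 - c) * v).
    by rewrite ler_wpM2r //; lra.
  have : (1 - c) * v * (b - (1 - a)) <= c * (b - (1 - a)).
    by rewrite ler_wpM2r //; lra.
  lra.
have [l|l] := leP b (a * u).
  have : 0 <= (1 - c) * v * (a * u - b) by rewrite !mulr_ge0 //; lra.
  lra.
have [lbc|lbc] := leP (1 - b) c.
  have e1 : (1 - c) * (v * b) * (b - a * u) <= (1 - c) * (1 - b) * (b - a * u).
    by rewrite ler_wpM2r ?ler_wpM2l //; lra.
  have e2 : a * ((1 - b) * u) * (b - (1 - c)) <= a * b * (b - (1 - c)).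
    by rewrite ler_wpM2r ?ler_wpM2l //; lra.
  have b_gt0 : 0 < b by apply: le_lt_trans l; rewrite mulr_ge0.
  by rewrite -(ler_pM2l b_gt0); nra.
have e1 : (1 - c) * v * (b - a * u) <= c * (b - a * u).
  by rewrite ler_wpM2r //; lra.
have e2 : a * ((1 - b) * u) * (1 - b - c) <= a * b * (1 - b - c).
  by rewrite ler_wpM2r ?ler_wpM2l //; lra.
have e3 : 0 <= (1 - b - c) * (1 - a - b) by rewrite mulr_ge0 //; lra.
have [b_lt1|b_ge1] := ltP b 1; last by lra.
rewrite -(@ler_pM2l _ (1 - b)); last by lra.
nra.
Qed.

Lemma cap_two p1 p2 p3 x1 x2 x3 z1 z2 z3 :
  0 <= p1 <= 1 -> 0 <= p2 <= 1 -> 0 <= p3 <= 1 ->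
  x1 <= 0 -> 0 <= x2 <= 1 -> 0 <= x3 <= 1 ->
  0 <= z1 <= 1 -> z2 <= 0 -> 0 <= z3 <= 1 ->
  0 <= p1 * x1 + (1 - p1) * x3 -> 0 <= p2 * x2 + (1 - p2) * x1 ->
  0 <= p2 * z2 + (1 - p2) * z1 -> 0 <= p3 * z3 + (1 - p3) * z2 ->
  0 <= p1 * (1 - p2) * (x1 * z1) + p2 * (1 - p3) * (x2 * z2)
       + p3 * (1 - p1) * (x3 * z3)
       + p1 * p2 * p3 + (1 - p1) * (1 - p2) * (1 - p3).
Proof.
move=> hp1 hp2 hp3 hx1 /andP[hx2 hx2'] /andP[hx3 hx3'].
move=> /andP[hz1 hz1'] hz2 /andP[hz3 hz3'] h1 h2 h3 h4.
have /andP[a0 a1] := hp1; have /andP[b0 b1] := hp2; have /andP[c0 c1] := hp3.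
have A0 : 0 <= 1 - p1 by lra.
have B0 : 0 <= 1 - p2 by lra.
have C0 : 0 <= 1 - p3 by lra.
have k1 : (1 - p1) * x3 <= 1 - p1 by rewrite ler_piMr.
have k2 : p2 * x2 <= p2 by rewrite ler_piMr.
have k3 : (1 - p2) * z1 <= 1 - p2 by rewrite ler_piMr.
have k4 : p3 * z3 <= p3 by rewrite ler_piMr.
have := @cap_corner p1 p2 p3 (- x1) (- z2) hp1 hp2 hp3.
have -> : 0 <= - x1 by lra.
have -> : 0 <= - z2 by lra.
have -> : p1 * (- x1) <= 1 - p1 by lra.
have -> : (1 - p2) * (- x1) <= p2 by lra.
have -> : p2 * (- z2) <= 1 - p2 by lra.
have -> : (1 - p3) * (- z2) <= p3 by lra.
do 6 move=> /(_ isT).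
(* With u = - x1 and v = - z2, the product of [x3] and [z3] makes up for the term in u v of
   [cap_corner]: [m1] trades [z3] for v, then [m2] trades [x3] for u. *)
have m1 : 0 <= (p3 * z3 + (1 - p3) * z2) * ((1 - p1) * x3) by rewrite !mulr_ge0.
have m2 : 0 <= (p1 * x1 + (1 - p1) * x3) * ((1 - p3) * - z2).
  by rewrite !mulr_ge0 //; lra.
have m3 : 0 <= p1 * (1 - p2) * - x1 * (1 - z1) by rewrite !mulr_ge0 //; lra.
have m4 : 0 <= p2 * (1 - p3) * - z2 * (1 - x2) by rewrite !mulr_ge0 //; lra.
lra.
Qed.

(** A touching point of L divides a side of the triangle in the ratio p : 1 - p, and x is 1 minus a
    corner term of M divided by that of the corner triangle of L. The last three conditions say that
    the two corners at the ends of a side together use up at most that side. *)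
Definition cap_adm p1 p2 p3 x1 x2 x3 :=
  [/\ [/\ 0 <= p1 <= 1, 0 <= p2 <= 1 & 0 <= p3 <= 1],
      [/\ x1 <= 1, x2 <= 1 & x3 <= 1]
    & [/\ 0 <= p1 * x1 + (1 - p1) * x3, 0 <= p2 * x2 + (1 - p2) * x1
        & 0 <= p3 * x3 + (1 - p3) * x2]].

(** The weights of the three products are the relative areas of the corner triangles cut off by the
    touching points; the last two terms add up to the relative area of the inscribed triangle in the
    middle. All together they sum to 1. *)
Definition cap_sum p1 p2 p3 x1 x2 x3 z1 z2 z3 :=
  p1 * (1 - p2) * (x1 * z1) + p2 * (1 - p3) * (x2 * z2)
  + p3 * (1 - p1) * (x3 * z3)
  + p1 * p2 * p3 + (1 - p1) * (1 - p2) * (1 - p3).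

Lemma cap_adm_rot p1 p2 p3 x1 x2 x3 :
  cap_adm p1 p2 p3 x1 x2 x3 -> cap_adm p2 p3 p1 x2 x3 x1.
Proof. by case=> [[? ? ?] [? ? ?] [? ? ?]]. Qed.

Lemma cap_sum_rot p1 p2 p3 x1 x2 x3 z1 z2 z3 :
  cap_sum p2 p3 p1 x2 x3 x1 z2 z3 z1 = cap_sum p1 p2 p3 x1 x2 x3 z1 z2 z3.
Proof. by rewrite /cap_sum; ring. Qed.

Lemma cap_sumC p1 p2 p3 x1 x2 x3 z1 z2 z3 :
  cap_sum p1 p2 p3 z1 z2 z3 x1 x2 x3 = cap_sum p1 p2 p3 x1 x2 x3 z1 z2 z3.
Proof. by rewrite /cap_sum; ring. Qed.

(** Any two of the x have a nonnegative weighted mean, so at most one of them is negative. *)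
Lemma cap_adm_signs p1 p2 p3 x1 x2 x3 : cap_adm p1 p2 p3 x1 x2 x3 ->
  [\/ [/\ 0 <= x1, 0 <= x2 & 0 <= x3], [/\ x1 < 0, 0 <= x2 & 0 <= x3],
      [/\ x2 < 0, 0 <= x3 & 0 <= x1] | [/\ x3 < 0, 0 <= x1 & 0 <= x2]].
Proof.
have two (p s t : R) : 0 <= p <= 1 -> 0 <= p * s + (1 - p) * t ->
    s < 0 -> t < 0 -> False by move=> /andP[? ?] ? ? ?; nra.
case=> [[P1 P2 P3] _ [h1 h2 h3]].
have [x1p|x1n] := leP 0 x1; have [x2p|x2n] := leP 0 x2;
  have [x3p|x3n] := leP 0 x3; try by first
    [by constructor 1 | by constructor 2 | by constructor 3 | by constructor 4].
- by exfalso; exact: two P3 h3 x3n x2n.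
- by exfalso; exact: two P1 h1 x1n x3n.
- by exfalso; exact: two P2 h2 x2n x1n.
- by exfalso; exact: two P2 h2 x2n x1n.
Qed.

Lemma cap_sum_neg_nneg p1 p2 p3 x1 x2 x3 z1 z2 z3 :
  cap_adm p1 p2 p3 x1 x2 x3 -> cap_adm p1 p2 p3 z1 z2 z3 ->
  x1 < 0 -> 0 <= x2 -> 0 <= x3 -> 0 <= z1 -> 0 <= z2 -> 0 <= z3 ->
  0 <= cap_sum p1 p2 p3 x1 x2 x3 z1 z2 z3.
Proof.
case=> [[P1 P2 P3] [X1 X2 X3] [h1 h2 h3]] [_ [Z1 Z2 Z3] _] *.
have z1p : 0 <= z1 <= 1 by apply/andP.
have := cap_one P1 P2 P3 (ltW _) X2 X3 z1p h1 h2; move=> /(_ _)/le_trans-> //.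
case/andP: P1 P2 P3 => _ P1 /andP[? ?] /andP[? ?].
rewrite /cap_sum !lerD2r -addrA lerDl.
by rewrite addr_ge0 // !mulr_ge0 ?subr_ge0.
Qed.

Lemma cap_sum_neg p1 p2 p3 x1 x2 x3 z1 z2 z3 :
  cap_adm p1 p2 p3 x1 x2 x3 -> cap_adm p1 p2 p3 z1 z2 z3 ->
  x1 < 0 -> 0 <= x2 -> 0 <= x3 ->
  0 <= cap_sum p1 p2 p3 x1 x2 x3 z1 z2 z3.
Proof.
move=> Ax Az x1n x2p x3p.
have [[P1 P2 P3] [X1 X2 X3] [h1 h2 h3]] := Ax.
have [_ [Z1 Z2 Z3] [k1 k2 k3]] := Az.
have := cap_adm_signs Az; case=> [][z1s z2s z3s].
- exact: cap_sum_neg_nneg.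
- case/andP: P1 P2 P3 => P1 P1' /andP[P2 P2'] /andP[P3 P3'].
  have t1 : 0 <= p1 * (1 - p2) * (x1 * z1).
    by apply: mulr_ge0; [rewrite mulr_ge0 ?subr_ge0|rewrite ltW // nmulr_rgt0].
  by rewrite /cap_sum !addr_ge0 // !mulr_ge0 ?subr_ge0.
- by apply: cap_two => //; first [exact: ltW | exact/andP].
(* After the swap and two rotations, [z3] takes the place of [x1] and [x1] that of [z2] in
   [cap_two]. *)
- rewrite -cap_sumC -cap_sum_rot -cap_sum_rot.
  by apply: cap_two => //; first [exact: ltW | exact/andP].
Qed.

Lemma cap_sum_ge0 p1 p2 p3 x1 x2 x3 z1 z2 z3 :
  cap_adm p1 p2 p3 x1 x2 x3 -> cap_adm p1 p2 p3 z1 z2 z3 ->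
  0 <= cap_sum p1 p2 p3 x1 x2 x3 z1 z2 z3.
Proof.
move=> Ax Az; have Ax' := cap_adm_rot Ax; have Az' := cap_adm_rot Az.
have Ax'' := cap_adm_rot Ax'; have Az'' := cap_adm_rot Az'.
have := cap_adm_signs Ax; case=> [][x1s x2s x3s].
- have := cap_adm_signs Az; case=> [][z1s z2s z3s]; first last.
  + rewrite -cap_sumC -cap_sum_rot -cap_sum_rot; exact: cap_sum_neg.
  + rewrite -cap_sumC -cap_sum_rot; exact: cap_sum_neg.
  + rewrite -cap_sumC; exact: cap_sum_neg.
  case: Ax => [[/andP[? ?] /andP[? ?] /andP[? ?]] _ _].
  by rewrite /cap_sum !addr_ge0 // !mulr_ge0 ?subr_ge0.
- exact: cap_sum_neg.
- rewrite -cap_sum_rot; exact: cap_sum_neg.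
- rewrite -cap_sum_rot -cap_sum_rot; exact: cap_sum_neg.
Qed.

End Cap.

(** * Polygons as lists of edges *)

Section Edges.
Variable R : realFieldType.
Implicit Types (a b c d e f : R * R) (K L M N : seq (R * R)).

Definition det2 a b : R := a.1 * b.2 - a.2 * b.1.

Definition edge_sum (f : R * R -> R * R) M : R * R :=
  (\sum_(a <- M) (f a).1, \sum_(a <- M) (f a).2).

Definition closed_edges M := edge_sum id M = (0, 0).

Lemma sum_det2 (f g : R * R -> R * R) M N :
  \sum_(a <- M) \sum_(b <- N) det2 (f a) (g b) = det2 (edge_sum f M) (edge_sum g N).
Proof.
rewrite /det2 /= mulr_suml mulr_suml -sumrB; apply: eq_bigr => a _.
by rewrite sumrB !mulr_sumr.
Qed.

Lemma edge_sum_det2 c M : \sum_(a <- M) det2 c a = det2 c (edge_sum id M).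
Proof. by rewrite /det2 sumrB !mulr_sumr. Qed.

Definition half_kernel c a b : R :=
  if (0 <= det2 c a) == (0 <= det2 c b) then `|det2 a b| else 0.

Definition vsum c M N := \sum_(a <- M) \sum_(b <- N) half_kernel c a b.

Lemma half_kernelC c a b : half_kernel c a b = half_kernel c b a.
Proof.
rewrite /half_kernel eq_sym; case: ifP => // _.
by rewrite -normrN; congr `| _ |; rewrite /det2; ring.
Qed.

Lemma vsumC c M N : vsum c M N = vsum c N M.
Proof.
rewrite /vsum exchange_big; apply: eq_bigr => b _; apply: eq_bigr => a _.
exact: half_kernelC.
Qed.

Lemma edge_sumD (f g h : R * R -> R * R) M :
  (forall a, f a = ((g a).1 + (h a).1, (g a).2 + (h a).2)) ->
  edge_sum f M = ((edge_sum g M).1 + (edge_sum h M).1, (edge_sum g M).2 + (edge_sum h M).2).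
Proof.
by move=> E; rewrite /edge_sum /= -!big_split; congr pair; apply: eq_bigr => a _;
  rewrite E.
Qed.

Lemma det2_plucker a b c d :
  det2 a b * det2 c d = det2 a c * det2 b d - det2 a d * det2 b c.
Proof. by rewrite /det2; ring. Qed.

Lemma det2C a b : det2 a b = - det2 b a.
Proof. by rewrite /det2; ring. Qed.

(* The lines of [c] and [d] cut the plane into four sectors; [o] keeps the part
   of a vector in two opposite ones and [n] its part in the two others. *)
Lemma half_kernel_diff c d a b : 0 < det2 c d ->
  let o x := if (0 <= det2 c x) == (0 <= det2 d x) then x else (0, 0) in
  let n x := if (0 <= det2 c x) == (0 <= det2 d x) then (0, 0) else x in
  half_kernel c a b - half_kernel d a b = det2 (n a) (o b) + det2 (n b) (o a).
Proof.
move=> D /=; rewrite /half_kernel.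
have P := det2_plucker c d a b.
have z1 x : det2 (0, 0) x = 0 by rewrite /det2 /= !mul0r subrr.
have z2 x : det2 x (0, 0) = 0 by rewrite /det2 /= !mulr0 subrr.
have pos : 0 <= det2 c a * det2 d b - det2 c b * det2 d a -> 0 <= det2 a b.
  by rewrite -P pmulr_rge0.
have neg : det2 c a * det2 d b - det2 c b * det2 d a <= 0 -> det2 a b <= 0.
  by rewrite -P pmulr_rle0.
have S := det2C b a.
have [ca|ca] := leP 0 (det2 c a); have [da|da] := leP 0 (det2 d a);
have [cb|cb] := leP 0 (det2 c b); have [db|db] := leP 0 (det2 d b);
rewrite /= ?eqxx /= ?z1 ?z2 ?subrr ?addr0 ?add0r ?subr0 ?sub0r //.
all: try (rewrite ger0_norm ?S //; apply: pos; nra).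
all: try (rewrite ler0_norm ?S ?opprK //; apply: neg; nra).
Qed.

(** Summed over both polygons, the difference of the kernels is a sum of two determinants in the
    total [n]- and [o]-parts. For a closed polygon these parts are opposite, and the two
    determinants cancel by antisymmetry. *)
Lemma vsum_cut_pos c d M N : closed_edges M -> closed_edges N ->
  0 < det2 c d -> vsum c M N = vsum d M N.
Proof.
move=> HM HN D; apply/eqP; rewrite -subr_eq0 /vsum -sumrB.
pose o x := if (0 <= det2 c x) == (0 <= det2 d x) then x else (0, 0).
pose n x := if (0 <= det2 c x) == (0 <= det2 d x) then (0, 0) else x.
under eq_bigr => a _.
  rewrite -sumrB.
  under eq_bigr => b _ do rewrite half_kernel_diff // -/(n a) -/(o b) -/(n b) -/(o a).
  rewrite big_split /=.
  over.
rewrite big_split /= sum_det2 exchange_big sum_det2.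
have split x : id x = ((o x).1 + (n x).1, (o x).2 + (n x).2).
  by rewrite /o /n; case: ifP => _ /=; rewrite ?addr0 ?add0r; case: x.
have := edge_sumD M split; have := edge_sumD N split; rewrite HM HN.
move: (edge_sum o M) (edge_sum n M) (edge_sum o N) (edge_sum n N) => [a a'] [b b'] [e e'] [f f'].
move=> /= [/eqP E1 /eqP E2] [/eqP E3 /eqP E4].
move: E1 E2 E3 E4; rewrite ![0 == _]eq_sym !addr_eq0.
move=> /eqP-> /eqP-> /eqP-> /eqP->; rewrite /det2 /=; apply/eqP; ring.
Qed.

Lemma vsum_cut c d M N : closed_edges M -> closed_edges N ->
  c != (0, 0) -> d != (0, 0) -> vsum c M N = vsum d M N.
Proof.
move=> HM HN c0 d0.
have sq (x : R * R) : x != (0, 0) -> 0 < x.1 ^+ 2 + x.2 ^+ 2.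
  case: x => x y /=; rewrite xpair_eqE lt_def addr_ge0 ?sqr_ge0 // andbT.
  by rewrite paddr_eq0 ?sqr_ge0 // !sqrf_eq0.
have W (x y : R * R) : det2 x y != 0 -> vsum x M N = vsum y M N.
  rewrite neq_lt => /orP[h|h]; last exact: vsum_cut_pos.
  by apply/esym/vsum_cut_pos => //; rewrite det2C oppr_gt0.
have [cd|cd] := eqVneq (det2 c d) 0; last exact: W.
(* Parallel cuts are compared through the perpendicular of [c], which is parallel to neither. *)
rewrite (W c (- c.2, c.1)); last first.
  by rewrite /det2 /= mulrN opprK gt_eqF // -!expr2 sq.
apply/esym/W; apply: contra c0 => /eqP h.
have E : (d.1 ^+ 2 + d.2 ^+ 2) * c.1 = 0 /\ (d.1 ^+ 2 + d.2 ^+ 2) * c.2 = 0.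
  split.
    have -> : (d.1 ^+ 2 + d.2 ^+ 2) * c.1
        = d.1 * det2 d (- c.2, c.1) + d.2 * det2 c d by rewrite /det2 /=; ring.
    by rewrite h cd !mulr0 addr0.
  have -> : (d.1 ^+ 2 + d.2 ^+ 2) * c.2
      = d.2 * det2 d (- c.2, c.1) - d.1 * det2 c d by rewrite /det2 /=; ring.
  by rewrite h cd !mulr0 subr0.
have d_neq0 : d.1 ^+ 2 + d.2 ^+ 2 != 0 by rewrite gt_eqF // sq.
case: E => /eqP; rewrite mulf_eq0 (negbTE d_neq0) /= => /eqP e1 /eqP.
rewrite mulf_eq0 (negbTE d_neq0) /= => /eqP e2.
by rewrite [c]surjective_pairing e1 e2.
Qed.

End Edges.

(** * Mixed area inside a circumscribed triangle, corner by corner *)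

Section Triangle.
Variable R : realFieldType.
Implicit Types (a b c d e f : R * R) (K L M N : seq (R * R)).

(* For [a] in the cone spanned by [e] and [f], the coordinates of [a] in the
   basis [(e, f)] multiplied by [det2 e f]. *)
Definition cone_fst e f a : R :=
  if (0 <= det2 e a) && (det2 f a < 0) then - det2 f a else 0.
Definition cone_snd e f a : R :=
  if (0 <= det2 e a) && (det2 f a < 0) then det2 e a else 0.

(** [corner e f a a] is [2 * det2 e f] times the area of the triangle that the edge [a] cuts off
    from the corner. For two edges of a convex boundary, the one closer to [e] comes first, and the
    parallelogram between them and the corner is the smaller of the two products. *)
Definition corner e f a b : R :=
  Num.min (cone_fst e f a * cone_snd e f b) (cone_fst e f b * cone_snd e f a).

Lemma cone_fst_ge0 e f a : 0 <= cone_fst e f a.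
Proof. by rewrite /cone_fst; case: ifP => // /andP[_ /ltW]; rewrite oppr_ge0. Qed.

Lemma cone_snd_ge0 e f a : 0 <= cone_snd e f a.
Proof. by rewrite /cone_snd; case: ifP => // /andP[]. Qed.

(* The coordinates [(det2 e1 x, det2 e2 x)] of the part of [x] in the cone
   spanned by [e1, e2], in the two halves (cut by the line of [e1]) of the cone
   spanned by [e2, e3], and in the cone spanned by [e3, e1]. *)
Definition sector (e1 e2 e3 : R * R) (i : nat) (x : R * R) : R * R :=
  let p := (det2 e1 x, det2 e2 x) in
  let j := if 0 <= det2 e1 x then (if det2 e2 x < 0 then 0%N else 1%N)
           else (if 0 <= det2 e3 x then 3%N else 2%N) in
  if i == j then p else (0, 0).

(** All absolute values and minima are on the left. The right-hand side is bilinear in the sector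
    parts of [a] and [b], so that its sum over two polygons depends only on the sums of the edges in
    each sector. *)
Lemma half_kernel_corners (e1 e2 e3 a b : R * R) :
  e1 + e2 + e3 = 0 -> 0 < det2 e1 e2 ->
  let s := sector e1 e2 e3 in
  let A1 := cone_fst e1 e2 in let A2 := cone_fst e2 e3 in
  let A3 := cone_fst e3 e1 in
  let B1 := cone_snd e1 e2 in let B2 := cone_snd e2 e3 in
  let B3 := cone_snd e3 e1 in
  det2 e1 e2 * half_kernel e1 a b
   + 2 * (corner e1 e2 a b + corner e2 e3 a b + corner e3 e1 a b) =
  (A1 a * B1 b + A1 b * B1 a) + (A2 a * B2 b + A2 b * B2 a)
  + (A3 a * B3 b + A3 b * B3 a)
  + (det2 (s 0%N a) (s 1%N b) + det2 (s 0%N b) (s 1%N a))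
  + (det2 (s 2%N a) (s 3%N b) + det2 (s 2%N b) (s 3%N a))
  - (det2 (s 1%N a) (s 2%N b) + det2 (s 1%N b) (s 2%N a)).
Proof.
move=> E0 D /=.
have F x : det2 e3 x = - det2 e1 x - det2 e2 x.
  have -> : e3 = (- e1.1 - e2.1, - e1.2 - e2.2).
    have -> : e3 = - (e1 + e2) by apply/eqP; rewrite -addr_eq0 addrC E0.
    by case: e1 {D E0} => ? ?; case: e2 => ? ?; congr pair => /=; rewrite opprD.
  by rewrite /det2 /=; ring.
have P : det2 e1 e2 * `|det2 a b| = `|det2 e1 a * det2 e2 b - det2 e1 b * det2 e2 a|.
  by rewrite -det2_plucker normrM (gtr0_norm D).
rewrite /half_kernel.
rewrite (fun_if ( *%R (det2 e1 e2))) mulr0 P.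
rewrite /sector /corner /cone_fst /cone_snd !F.
move: (det2 e1 a) (det2 e2 a) (det2 e1 b) (det2 e2 b) => x y z t {P F E0 D}.
(* Written this way, the minima at all three corners involve the same absolute value as the kernel,
   by [n1], [n2] and [n3]. *)
have min2 (u v : R) : 2 * Num.min u v = u + v - `|u - v|.
  by have [h|h] := leP u v; [rewrite ler0_norm|rewrite gtr0_norm]; lra.
rewrite !mulrDr !min2 {min2} /det2.
have n1 : `|- y * z - - t * x| = `|x * t - z * y| by congr `| _ |; ring.
have n2 : `|- (- x - y) * t - - (- z - t) * y| = `|x * t - z * y|.
  by congr `| _ |; ring.
have n3 : `|- x * (- z - t) - - z * (- x - y)| = `|x * t - z * y|.
  by congr `| _ |; ring.
have pos : 0 <= x * t - z * y -> `|x * t - z * y| = x * t - z * y.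
  by move=> ?; rewrite ger0_norm.
have neg : x * t - z * y <= 0 -> `|x * t - z * y| = z * y - x * t.
  by move=> ?; rewrite ler0_norm // opprB.
move: n1 n2 n3 pos neg.
have [x0|x0] := leP 0 x; have [y0|y0] := leP 0 y;
  have [z0|z0] := leP 0 z; have [t0|t0] := leP 0 t;
  rewrite /= ?andbF /=;
  have [w0|w0] := leP 0 (- x - y); rewrite /= ?andbF /=;
  have [u0|u0] := leP 0 (- z - t); rewrite /= ?andbF /=
    ?(mulr0, mul0r) ?(subr0, sub0r, oppr0, addr0, add0r, normr0);
  move=> n1 n2 n3 pos neg; rewrite ?n1 ?n2 ?n3 {n1 n2 n3}; try (by ring);
  try (by exfalso; clear pos neg; lra).
all: try (have h : 0 <= x * t - z * y by clear - x0 y0 z0 t0 w0 u0; nra);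
  try (rewrite (pos h); ring).
all: have h' : x * t - z * y <= 0 by clear - x0 y0 z0 t0 w0 u0; nra.
all: try (rewrite (neg h'); ring).
all: have e : x * t - z * y = 0 by apply/eqP; rewrite eq_le h' h.
all: rewrite ?e ?normr0; clear - e; lra.
Qed.
End Triangle.

Section TriangleSum.
Variable R : realFieldType.
Implicit Types (a b c d e f : R * R) (K L M N : seq (R * R)).

Lemma sum_mul2 (T : Type) (f g : T -> R) (M N : seq T) :
  \sum_(a <- M) \sum_(b <- N) f a * g b
    = (\sum_(a <- M) f a) * (\sum_(b <- N) g b).
Proof. by rewrite mulr_suml; apply: eq_bigr => a _; rewrite mulr_sumr. Qed.

Lemma sum_mul2C (T : Type) (f g : T -> R) (M N : seq T) :
  \sum_(a <- M) \sum_(b <- N) f b * g a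
    = (\sum_(b <- N) f b) * (\sum_(a <- M) g a).
Proof. by rewrite exchange_big sum_mul2. Qed.

Definition corners e f M N := \sum_(a <- M) \sum_(b <- N) corner e f a b.

Section Fixed.
Variables e1 e2 e3 : R * R.
Hypotheses (E0 : e1 + e2 + e3 = 0) (D : 0 < det2 e1 e2).

Lemma det2_third x : det2 e3 x = - det2 e1 x - det2 e2 x.
Proof.
have -> : e3 = - (e1 + e2) by apply/eqP; rewrite -addr_eq0 addrC E0.
by rewrite /det2 /=; ring.
Qed.

Local Notation S M i := (edge_sum (sector e1 e2 e3 i) M).

Lemma sum_cone12 M : \sum_(a <- M) cone_fst e1 e2 a = - (S M 0%N).2 /\
  \sum_(a <- M) cone_snd e1 e2 a = (S M 0%N).1.
Proof.
rewrite -sumrN; split; apply: eq_bigr => a _;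
rewrite /cone_fst /cone_snd /sector;
by case: (leP 0 (det2 e1 a)) => //= _; case: ifP => //=; rewrite ?oppr0 //;
  case: ifP => //=; rewrite ?oppr0.
Qed.

Lemma sum_cone23 M : \sum_(a <- M) cone_fst e2 e3 a =
    (S M 1%N).1 + (S M 1%N).2 + (S M 2%N).1 + (S M 2%N).2 /\
  \sum_(a <- M) cone_snd e2 e3 a = (S M 1%N).2 + (S M 2%N).2.
Proof.
rewrite -!big_split /=; split; apply: eq_bigr => a _;
rewrite /cone_fst /cone_snd /sector det2_third;
have [x0|x0] := leP 0 (det2 e1 a); have [y0|y0] := leP 0 (det2 e2 a);
have [z0|z0] := leP 0 (- det2 e1 a - det2 e2 a) => //=;
by rewrite ?addr0 ?add0r //; lra.
Qed.

Lemma sum_cone31 M : \sum_(a <- M) cone_fst e3 e1 a = - (S M 3%N).1 /\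
  \sum_(a <- M) cone_snd e3 e1 a = - (S M 3%N).1 - (S M 3%N).2.
Proof.
rewrite -!sumrN -!big_split /=; split; apply: eq_bigr => a _;
rewrite /cone_fst /cone_snd /sector det2_third;
have [x0|x0] := leP 0 (det2 e1 a); have [y0|y0] := leP 0 (det2 e2 a);
have [z0|z0] := leP 0 (- det2 e1 a - det2 e2 a) => //=;
by rewrite ?addr0 ?add0r //; lra.
Qed.

Lemma sum_sectors M : closed_edges M ->
  (S M 0%N).1 + (S M 1%N).1 + (S M 2%N).1 + (S M 3%N).1 = 0 /\
  (S M 0%N).2 + (S M 1%N).2 + (S M 2%N).2 + (S M 3%N).2 = 0.
Proof.
move=> HM.
have Z e : \sum_(a <- M) det2 e a = 0.
  by rewrite edge_sum_det2 HM /det2 /= !mulr0 subrr.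
split; [rewrite -[RHS](Z e1) | rewrite -[RHS](Z e2)];
  rewrite -!big_split /=; apply: eq_bigr => a _; rewrite /sector;
  case: (leP 0 (det2 e1 a)) => _; case: (ltP (det2 e2 a) 0) => _;
  by case: (leP 0 (det2 e3 a)) => _; rewrite /= ?addr0 ?add0r.
Qed.

(* [det2 e1 e2] times the ratio of the smallest homothetic copy of the triangle
   with edges [e1], [e2], [e3] that contains the polygon. *)
Definition circumscale M :=
  \sum_(a <- M) cone_fst e1 e2 a + \sum_(a <- M) cone_snd e3 e1 a.

(** Each sum consists of the two parts into which a touching point divides one side of the
    circumscribed triangle. The three sides are the same multiple of [e1], [e2], [e3] because the
    edges of the polygon sum to zero. *)
Lemma circumscaleE M : closed_edges M ->
  \sum_(a <- M) cone_fst e2 e3 a + \sum_(a <- M) cone_snd e1 e2 a = circumscale M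
  /\ \sum_(a <- M) cone_fst e3 e1 a + \sum_(a <- M) cone_snd e2 e3 a = circumscale M.
Proof.
move=> HM; rewrite /circumscale; have [h1 h2] := sum_sectors HM.
case: (sum_cone12 M) => -> ->; case: (sum_cone23 M) => -> ->.
case: (sum_cone31 M) => -> ->.
by split; lra.
Qed.

(* If both polygons touch the three sides of the triangle from inside, then the
   circumscales are [det2 e1 e2] and the mixed area is the area of the triangle
   minus one term for each corner. *)
Lemma vsum_corners M N : closed_edges M -> closed_edges N ->
  det2 e1 e2 * vsum e1 M N
  + 2 * (corners e1 e2 M N + corners e2 e3 M N + corners e3 e1 M N)
  = 2 * (circumscale M * circumscale N).
Proof.
move=> HM HN.
have [hM1 hM2] := sum_sectors HM; have [hN1 hN2] := sum_sectors HN.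
rewrite /vsum /corners -!big_split /= !mulr_sumr -big_split /=.
under eq_bigr => a _.
  rewrite -!big_split /= !mulr_sumr -big_split /=.
  under eq_bigr => b _ do rewrite (half_kernel_corners a b E0 D).
  rewrite !(sumrB, big_split) /=.
  over.
rewrite !(sumrB, big_split) /= !sum_mul2 !sum_mul2C.
rewrite /circumscale.
case: (sum_cone12 M) => -> ->; case: (sum_cone23 M) => -> ->.
case: (sum_cone31 M) => -> ->.
case: (sum_cone12 N) => -> ->; case: (sum_cone23 N) => -> ->.
case: (sum_cone31 N) => -> ->.
move: hM1 hM2 hN1 hN2; rewrite /edge_sum /=.
do 16 (move: (\sum_(_ <- _) _) => ?).
do 4 (move=> /eqP; rewrite addr_eq0 eq_sym eqr_oppLR => /eqP ->).
ring.
Qed.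

End Fixed.
End TriangleSum.

(** * From the polynomial inequality to an inequality between corner terms *)

Section CornerBounds.
Variable R : realFieldType.
Implicit Types (a b c d e f : R * R) (K L M N : seq (R * R)).

(* [Y = X / (p * q)], except that [Y = 0] when [p * q = 0]. *)
Lemma corner_rescale (p q A B X : R) : 0 <= p -> 0 <= q -> 0 <= A -> 0 <= B ->
  0 <= X -> X <= p * B -> X <= q * A ->
  exists Y, [/\ 0 <= Y, p * q * Y = X, p * Y <= A & q * Y <= B].
Proof.
move=> p0 q0 A0 B0 X0 XB XA.
have [p_gt0|p_le0] := ltP 0 p; last first.
  have pE : p = 0 by apply/eqP; rewrite eq_le p_le0.
  exists 0; rewrite !mulr0; split=> //; apply/eqP.
  by rewrite eq_sym eq_le X0 andbT -(mul0r B) -pE.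
have [q_gt0|q_le0] := ltP 0 q; last first.
  have qE : q = 0 by apply/eqP; rewrite eq_le q_le0.
  exists 0; rewrite !mulr0; split=> //; apply/eqP.
  by rewrite eq_sym eq_le X0 andbT -(mul0r A) -qE.
have [pN qN] : p != 0 /\ q != 0 by rewrite !gt_eqF.
exists (X / (p * q)); split.
- by rewrite divr_ge0 // mulr_ge0.
- by field; rewrite pN qN.
- have -> : p * (X / (p * q)) = X / q by field; rewrite pN qN.
  by rewrite ler_pdivrMr // mulrC.
- have -> : q * (X / (p * q)) = X / p by field; rewrite pN qN.
  by rewrite ler_pdivrMr // mulrC.
Qed.

Lemma cap_adm_compl (p1 p2 p3 q1 q2 q3 Y Y' Y'' : R) :
  p1 + q3 = 1 -> p2 + q1 = 1 -> p3 + q2 = 1 ->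
  0 <= p1 -> 0 <= p2 -> 0 <= p3 -> 0 <= q1 -> 0 <= q2 -> 0 <= q3 ->
  0 <= Y -> 0 <= Y' -> 0 <= Y'' ->
  p1 * Y + q3 * Y'' <= 1 -> p2 * Y' + q1 * Y <= 1 -> p3 * Y'' + q2 * Y' <= 1 ->
  cap_adm p1 p2 p3 (1 - Y) (1 - Y') (1 - Y'').
Proof.
move=> P1 P2 P3 *; have e3 : q3 = 1 - p1 by lra.
have e1 : q1 = 1 - p2 by lra.
have e2 : q2 = 1 - p3 by lra.
by split; split; rewrite -?e1 -?e2 -?e3; first [apply/andP; split; lra | lra].
Qed.

(** Write each X as p q Y and each X' as p q Z, so that E is at least p q Y Z. The right side minus
    the left is then at least [cap_sum] at the numbers 1 - Y and 1 - Z, because the weights and the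
    constant terms of [cap_sum] add up to 1. *)
Lemma corner_ineq1 (p1 p2 p3 q1 q2 q3 A1 A2 A3 B1 B2 B3 : R)
  (A1' A2' A3' B1' B2' B3' X1 X2 X3 X1' X2' X3' E1 E2 E3 : R) :
  (forall x, x \in [:: p1; p2; p3; q1; q2; q3; A1; A2; A3; B1; B2; B3; A1'; A2';
     A3'; B1'; B2'; B3'; X1; X2; X3; X1'; X2'; X3'; E1; E2; E3] -> 0 <= x) ->
  p1 + q3 = 1 -> p2 + q1 = 1 -> p3 + q2 = 1 ->
  A1 + B3 = 1 -> A2 + B1 = 1 -> A3 + B2 = 1 ->
  A1' + B3' = 1 -> A2' + B1' = 1 -> A3' + B2' = 1 ->
  X1 <= p1 * B1 -> X1 <= q1 * A1 -> X2 <= p2 * B2 -> X2 <= q2 * A2 ->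
  X3 <= p3 * B3 -> X3 <= q3 * A3 ->
  X1' <= p1 * B1' -> X1' <= q1 * A1' -> X2' <= p2 * B2' -> X2' <= q2 * A2' ->
  X3' <= p3 * B3' -> X3' <= q3 * A3' ->
  X1 * X1' <= p1 * q1 * E1 -> X2 * X2' <= p2 * q2 * E2 ->
  X3 * X3' <= p3 * q3 * E3 ->
  (X1' + X2' + X3') + (X1 + X2 + X3) <= 1 + (E1 + E2 + E3).
Proof.
move=> pos P1 P2 P3 hA1 hA2 hA3 hA1' hA2' hA3'.
move=> x1 x1' x2 x2' x3 x3' y1 y1' y2 y2' y3 y3' h1 h2 h3.
have [|||||Y1 [Y10 Y1X Y1A Y1B]] := corner_rescale _ _ _ _ _ x1 x1';
  try by apply: pos; rewrite !inE eqxx ?orbT.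
have [|||||Y2 [Y20 Y2X Y2A Y2B]] := corner_rescale _ _ _ _ _ x2 x2';
  try by apply: pos; rewrite !inE eqxx ?orbT.
have [|||||Y3 [Y30 Y3X Y3A Y3B]] := corner_rescale _ _ _ _ _ x3 x3';
  try by apply: pos; rewrite !inE eqxx ?orbT.
have [|||||Z1 [Z10 Z1X Z1A Z1B]] := corner_rescale _ _ _ _ _ y1 y1';
  try by apply: pos; rewrite !inE eqxx ?orbT.
have [|||||Z2 [Z20 Z2X Z2A Z2B]] := corner_rescale _ _ _ _ _ y2 y2';
  try by apply: pos; rewrite !inE eqxx ?orbT.
have [|||||Z3 [Z30 Z3X Z3A Z3B]] := corner_rescale _ _ _ _ _ y3 y3';
  try by apply: pos; rewrite !inE eqxx ?orbT.
have [p10 p20 p30] : [/\ 0 <= p1, 0 <= p2 & 0 <= p3].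
  by split; apply: pos; rewrite !inE eqxx ?orbT.
have [q10 q20 q30] : [/\ 0 <= q1, 0 <= q2 & 0 <= q3].
  by split; apply: pos; rewrite !inE eqxx ?orbT.
have [E10 E20 E30] : [/\ 0 <= E1, 0 <= E2 & 0 <= E3].
  by split; apply: pos; rewrite !inE eqxx ?orbT.
have cancel (p q Y Z X X' E : R) : 0 <= p -> 0 <= q -> 0 <= E ->
    p * q * Y = X -> p * q * Z = X' -> X * X' <= p * q * E ->
    p * q * (Y * Z) <= E.
  move=> p0 q0 E0 <- <-; have := mulr_ge0 p0 q0; rewrite le_eqVlt.
  move=> /orP[/eqP<-|h]; first by rewrite !mul0r.
  have -> : p * q * Y * (p * q * Z) = p * q * (p * q * (Y * Z)) by ring.
  by rewrite ler_pM2l.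
have k1 := cancel _ _ _ _ _ _ _ p10 q10 E10 Y1X Z1X h1.
have k2 := cancel _ _ _ _ _ _ _ p20 q20 E20 Y2X Z2X h2.
have k3 := cancel _ _ _ _ _ _ _ p30 q30 E30 Y3X Z3X h3.
rewrite -Y1X -Y2X -Y3X -Z1X -Z2X -Z3X.
have e3 : q3 = 1 - p1 by rewrite -P1 addrC addKr.
have e1 : q1 = 1 - p2 by rewrite -P2 addrC addKr.
have e2 : q2 = 1 - p3 by rewrite -P3 addrC addKr.
have admY : cap_adm p1 p2 p3 (1 - Y1) (1 - Y2) (1 - Y3).
  by apply: (cap_adm_compl P1 P2 P3) => //;
    [rewrite -hA1|rewrite -hA2|rewrite -hA3]; rewrite lerD.
have admZ : cap_adm p1 p2 p3 (1 - Z1) (1 - Z2) (1 - Z3).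
  by apply: (cap_adm_compl P1 P2 P3) => //;
    [rewrite -hA1'|rewrite -hA2'|rewrite -hA3']; rewrite lerD.
have h := cap_sum_ge0 admY admZ.
apply: (@le_trans _ _ (1 + (p1 * q1 * (Y1 * Z1) + p2 * q2 * (Y2 * Z2) + p3 * q3 * (Y3 * Z3)))); last by rewrite lerD2l !lerD.
rewrite -subr_ge0; apply: le_trans h _; rewrite le_eqVlt; apply/orP; left; apply/eqP.
by rewrite /cap_sum e1 e2 e3; ring.
Qed.

(** The homogeneous form of [corner_ineq1]: [r], [s], [t] are the sizes of the triangles
    circumscribed about the three polygons. *)
Lemma corner_ineq (r s t p1 p2 p3 q1 q2 q3 A1 A2 A3 B1 B2 B3 : R)
  (A1' A2' A3' B1' B2' B3' X1 X2 X3 X1' X2' X3' E1 E2 E3 : R) :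
  (forall x, x \in [:: p1; p2; p3; q1; q2; q3; A1; A2; A3; B1; B2; B3; A1'; A2';
     A3'; B1'; B2'; B3'; X1; X2; X3; X1'; X2'; X3'; E1; E2; E3] -> 0 <= x) ->
  0 < r -> 0 < s -> 0 < t ->
  p1 + q3 = r -> p2 + q1 = r -> p3 + q2 = r ->
  A1 + B3 = s -> A2 + B1 = s -> A3 + B2 = s ->
  A1' + B3' = t -> A2' + B1' = t -> A3' + B2' = t ->
  X1 <= p1 * B1 -> X1 <= q1 * A1 -> X2 <= p2 * B2 -> X2 <= q2 * A2 ->
  X3 <= p3 * B3 -> X3 <= q3 * A3 ->
  X1' <= p1 * B1' -> X1' <= q1 * A1' -> X2' <= p2 * B2' -> X2' <= q2 * A2' ->
  X3' <= p3 * B3' -> X3' <= q3 * A3' ->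
  X1 * X1' <= p1 * q1 * E1 -> X2 * X2' <= p2 * q2 * E2 ->
  X3 * X3' <= p3 * q3 * E3 ->
  s * (X1' + X2' + X3') + t * (X1 + X2 + X3) <= r * s * t + r * (E1 + E2 + E3).
Proof.
move=> pos r0 s0 t0 P1 P2 P3 hA1 hA2 hA3 hA1' hA2' hA3'.
move=> x1 x1' x2 x2' x3 x3' y1 y1' y2 y2' y3 y3' h1 h2 h3.
have [rN sN tN] : [/\ r != 0, s != 0 & t != 0] by rewrite !gt_eqF.
have D (u v w : R) : w != 0 -> u + v = w -> u / w + v / w = 1.
  by move=> w0 uv; rewrite -mulrDl uv divff.
have Q (x u v m : R) : 0 < m -> x <= u * v -> x / (r * m) <= u / r * (v / m).
  move=> m0 xuv; have -> : u / r * (v / m) = u * v / (r * m).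
    by field; rewrite rN gt_eqF.
  by rewrite ler_pM2r // invr_gt0 mulr_gt0.
have W (x y u v e : R) : x * y <= u * v * e ->
    x / (r * s) * (y / (r * t)) <= u / r * (v / r) * (e / (s * t)).
  move=> xy; have -> : x / (r * s) * (y / (r * t)) = x * y / (r ^+ 2 * s * t).
    by field; rewrite rN sN tN.
  have -> : u / r * (v / r) * (e / (s * t)) = u * v * e / (r ^+ 2 * s * t).
    by field; rewrite rN sN tN.
  by rewrite ler_pM2r // invr_gt0 !mulr_gt0 ?exprn_gt0.
have K : X1' / (r * t) + X2' / (r * t) + X3' / (r * t)
    + (X1 / (r * s) + X2 / (r * s) + X3 / (r * s))
    <= 1 + (E1 / (s * t) + E2 / (s * t) + E3 / (s * t)).
  apply: (@corner_ineq1 (p1 / r) (p2 / r) (p3 / r) (q1 / r) (q2 / r) (q3 / r)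
    (A1 / s) (A2 / s) (A3 / s) (B1 / s) (B2 / s) (B3 / s)
    (A1' / t) (A2' / t) (A3' / t) (B1' / t) (B2' / t) (B3' / t));
  try by [apply: D | apply: Q | apply: W].
  move=> x; rewrite !inE; repeat (move=> /orP[/eqP->|]); try move=> /eqP->;
  by rewrite divr_ge0 ?mulr_ge0 ?(ltW r0) ?(ltW s0) ?(ltW t0) //;
    apply: pos; rewrite !inE eqxx ?orbT.
have rst : 0 < r * s * t by rewrite !mulr_gt0.
move: K; rewrite -(ler_pM2l rst).
have -> : r * s * t * (X1' / (r * t) + X2' / (r * t) + X3' / (r * t)
    + (X1 / (r * s) + X2 / (r * s) + X3 / (r * s)))
  = s * (X1' + X2' + X3') + t * (X1 + X2 + X3) by field; rewrite rN sN tN.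
have -> // : r * s * t * (1 + (E1 / (s * t) + E2 / (s * t) + E3 / (s * t)))
  = r * s * t + r * (E1 + E2 + E3) by field; rewrite sN tN.
Qed.

End CornerBounds.

(** * The inequality when K is a triangle *)

Section Plucker.
Variable R : realFieldType.
Implicit Types (a b c d e f : R * R) (K L M N : seq (R * R)).

(* The corner term of [M] and of the polygon whose boundary in the cone of
   [(e, f)] is a single edge, namely the sum of the edges of [L] in that cone. *)
Definition clipped e f L M : R :=
  \sum_(b <- M) Num.min ((\sum_(a <- L) cone_fst e f a) * cone_snd e f b)
                        ((\sum_(a <- L) cone_snd e f a) * cone_fst e f b).

Lemma sum_cone_fst_ge0 e f M : 0 <= \sum_(a <- M) cone_fst e f a.
Proof. by apply: sumr_ge0 => a _; apply: cone_fst_ge0. Qed.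

Lemma sum_cone_snd_ge0 e f M : 0 <= \sum_(a <- M) cone_snd e f a.
Proof. by apply: sumr_ge0 => a _; apply: cone_snd_ge0. Qed.

Lemma clipped_ge0 e f L M : 0 <= clipped e f L M.
Proof.
apply: sumr_ge0 => a _.
by rewrite le_min !mulr_ge0 ?cone_fst_ge0 ?cone_snd_ge0 ?sum_cone_fst_ge0
  ?sum_cone_snd_ge0.
Qed.

Lemma clipped_le_snd e f L M : clipped e f L M
  <= (\sum_(a <- L) cone_fst e f a) * \sum_(b <- M) cone_snd e f b.
Proof. by rewrite mulr_sumr; apply: ler_sum => b _; rewrite ge_min lexx. Qed.

Lemma clipped_le_fst e f L M : clipped e f L M
  <= (\sum_(a <- L) cone_snd e f a) * \sum_(b <- M) cone_fst e f b.
Proof.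
by rewrite mulr_sumr; apply: ler_sum => b _; rewrite ge_min lexx orbT.
Qed.

Lemma corners_ge0 e f M N : 0 <= corners e f M N.
Proof.
apply: sumr_ge0 => a _; apply: sumr_ge0 => b _.
by rewrite /corner le_min !mulr_ge0 ?cone_fst_ge0 ?cone_snd_ge0.
Qed.

(** A sum of minima is at most the minimum of the sums: the chord cuts off more of the corner than
    the boundary of [L] does. *)
Lemma corners_le_clipped e f L M : corners e f L M <= clipped e f L M.
Proof.
rewrite /corners exchange_big; apply: ler_sum => b _ /=.
rewrite le_min !mulr_suml; apply/andP; split; apply: ler_sum => a _.
  by rewrite /corner ge_min lexx.
by rewrite /corner [X in _ <= X]mulrC ge_min lexx orbT.
Qed.

(** This holds term by term: choosing opposite entries in the two minima on the left bounds their
    product by either of the products compared in [corner], times both sums over [L]. It is the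
    lower bound for the corner terms of [M] and [N] on which [corners_triangle] rests. *)
Lemma clipped_mul_le e f L M N : clipped e f L M * clipped e f L N
  <= (\sum_(a <- L) cone_fst e f a) * (\sum_(a <- L) cone_snd e f a)
     * corners e f M N.
Proof.
rewrite /clipped /corners -sum_mul2 mulr_sumr; apply: ler_sum => a _.
rewrite mulr_sumr; apply: ler_sum => b _.
move: (sum_cone_fst_ge0 e f L) (sum_cone_snd_ge0 e f L).
move: (\sum_(_ <- _) _) (\sum_(_ <- _) _) => q p p0 q0.
have a1 := cone_fst_ge0 e f a; have a2 := cone_snd_ge0 e f a.
have b1 := cone_fst_ge0 e f b; have b2 := cone_snd_ge0 e f b.
have ma (x y : R) : 0 <= x -> 0 <= y -> 0 <= Num.min (p * x) (q * y).
  by move=> ? ?; rewrite le_min !mulr_ge0.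
rewrite /corner [X in _ <= X]minr_pMr ?mulr_ge0 // le_min; apply/andP; split.
- apply: (@le_trans _ _ ((q * cone_fst e f a) * (p * cone_snd e f b))).
    by apply: ler_pM; [exact: ma|exact: ma|rewrite ge_min lexx ?orbT|rewrite ge_min lexx ?orbT].
  by rewrite le_eqVlt; apply/orP; left; apply/eqP; ring.
- apply: (@le_trans _ _ ((p * cone_snd e f a) * (q * cone_fst e f b))).
    by apply: ler_pM; [exact: ma|exact: ma|rewrite ge_min lexx ?orbT|rewrite ge_min lexx ?orbT].
  by rewrite le_eqVlt; apply/orP; left; apply/eqP; ring.
Qed.

Section Fixed.
Variables e1 e2 e3 : R * R.
Hypotheses (E0 : e1 + e2 + e3 = 0) (D : 0 < det2 e1 e2).

Local Notation r := (circumscale e1 e2 e3).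

Lemma circumscale_ge0 M : 0 <= r M.
Proof. by rewrite addr_ge0 ?sum_cone_fst_ge0 ?sum_cone_snd_ge0. Qed.

Definition all_corners M N :=
  corners e1 e2 M N + corners e2 e3 M N + corners e3 e1 M N.

Lemma all_corners_ge0 M N : 0 <= all_corners M N.
Proof. by rewrite !addr_ge0 ?corners_ge0. Qed.

Lemma circumscale0_corners L M : closed_edges L -> r L = 0 -> all_corners L M = 0.
Proof.
move=> HL r0; apply/eqP; rewrite eq_le all_corners_ge0 andbT.
have [k1 k2] := circumscaleE E0 HL; rewrite r0 in k1 k2.
have z (x y : R) : 0 <= x -> 0 <= y -> x + y = 0 -> x = 0 /\ y = 0 by move=> *; lra.
have [||u1 v3] := z _ _ _ _ r0;
  [exact: sum_cone_fst_ge0|exact: sum_cone_snd_ge0|].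
have [||u2 v1] := z _ _ _ _ k1;
  [exact: sum_cone_fst_ge0|exact: sum_cone_snd_ge0|].
have [||u3 v2] := z _ _ _ _ k2;
  [exact: sum_cone_fst_ge0|exact: sum_cone_snd_ge0|].
rewrite /all_corners -[0]addr0 -[X in X + 0]addr0.
by rewrite !lerD //; apply: le_trans (corners_le_clipped _ _ _ _) _;
  apply: le_trans (clipped_le_snd _ _ _ _) _; rewrite ?u1 ?u2 ?u3 mul0r.
Qed.

Lemma cornersC e f M N : corners e f M N = corners e f N M.
Proof.
rewrite /corners exchange_big; apply: eq_bigr => b _; apply: eq_bigr => a _.
by rewrite /corner minC.
Qed.

(** This is [vsum_triangle_ineq] once each [vsum] is expressed by [vsum_corners]. *)
Lemma corners_triangle L M N : closed_edges L -> closed_edges M ->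
  closed_edges N ->
  r M * all_corners L N + r N * all_corners L M
    <= r L * r M * r N + r L * all_corners M N.
Proof.
move=> HL HM HN.
have allC X Y : all_corners X Y = all_corners Y X.
  by rewrite /all_corners !(cornersC _ _ X).
(* [corner_ineq] needs positive sizes. A polygon of size zero is a point and has no corner terms,
   which settles these cases directly. *)
have := circumscale_ge0 L; rewrite le_eqVlt => /orP[/eqP L0|L0].
  have rL := esym L0; rewrite !(circumscale0_corners _ HL rL) rL.
  by rewrite !(mul0r, mulr0) addr0.
have := circumscale_ge0 M; rewrite le_eqVlt => /orP[/eqP M0|M0].
  have rM := esym M0; rewrite (allC L M) !(circumscale0_corners _ HM rM) rM.
  by rewrite !(mul0r, mulr0) !add0r.
have := circumscale_ge0 N; rewrite le_eqVlt => /orP[/eqP N0|N0].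
  have rN := esym N0; rewrite (allC L N) !(circumscale0_corners _ HN rN) rN.
  rewrite !(mul0r, mulr0) !add0r.
  by rewrite mulr_ge0 ?circumscale_ge0 ?all_corners_ge0.
have [l1 l2] := circumscaleE E0 HL; have [m1 m2] := circumscaleE E0 HM.
have [n1 n2] := circumscaleE E0 HN.
apply: (@le_trans _ _ (
  r M * (clipped e1 e2 L N + clipped e2 e3 L N + clipped e3 e1 L N)
  + r N * (clipped e1 e2 L M + clipped e2 e3 L M + clipped e3 e1 L M))).
  by apply: lerD; (apply: ler_wpM2l; first exact: ltW);
    rewrite !lerD ?corners_le_clipped.
apply: (corner_ineq _ L0 M0 N0 (erefl _) l1 l2 (erefl _) m1 m2 (erefl _) n1 n2);
  try exact: clipped_le_snd; try exact: clipped_le_fst;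
  try exact: clipped_mul_le.
move=> x; rewrite !inE; repeat (move=> /orP[/eqP->|]); try move=> /eqP->;
by rewrite ?sum_cone_fst_ge0 ?sum_cone_snd_ge0 ?clipped_ge0 ?corners_ge0.
Qed.

Lemma vsum_triangle_ineq L M N : closed_edges L -> closed_edges M ->
  closed_edges N ->
  r L * vsum e1 M N <= r M * vsum e1 L N + r N * vsum e1 L M.
Proof.
move=> HL HM HN; rewrite -(ler_pM2l D).
have := corners_triangle HL HM HN; rewrite /all_corners.
have := vsum_corners E0 D HM HN; have := vsum_corners E0 D HL HM.
have := vsum_corners E0 D HL HN.
move: (corners _ _ _ _ + _ + _) (corners _ _ _ _ + _ + _) (corners _ _ _ _ + _ + _).
move: (vsum _ _ _) (vsum _ _ _) (vsum _ _ _) (circumscale _ _ _ _)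
  (circumscale _ _ _ _) (circumscale _ _ _ _) (det2 _ _).
move=> v v0 v1 rm rn rl d c0 c1 c2 h1 h2 h3 h.
have e1' : d * v1 = 2 * (rl * rn) - 2 * c2 by rewrite -h1 addrK.
have e2' : d * v0 = 2 * (rl * rm) - 2 * c1 by rewrite -h2 addrK.
have e3' : d * v = 2 * (rm * rn) - 2 * c0 by rewrite -h3 addrK.
by rewrite mulrDr ![d * (_ * _)]mulrCA e1' e2' e3'; lra.
Qed.

Lemma vsum_triangle M : closed_edges M ->
  vsum e1 [:: e1; e2; e3] M = 2 * circumscale e1 e2 e3 M.
Proof.
move=> HM; set T := [:: e1; e2; e3].
have self x : det2 x x = 0 by rewrite /det2; ring.
have d21 : det2 e2 e1 = - det2 e1 e2 by rewrite /det2; ring.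
have d31 : det2 e3 e1 = det2 e1 e2 by rewrite (det2_third E0) self d21; ring.
have d32 : det2 e3 e2 = - det2 e1 e2 by rewrite (det2_third E0) self; ring.
have d13 : det2 e1 e3 = - det2 e1 e2 by rewrite det2C d31.
have d23 : det2 e2 e3 = det2 e1 e2 by rewrite det2C d32 opprK.
have HT : closed_edges T.
  rewrite /closed_edges /edge_sum !big_cons !big_nil /= !addr0.
  by rewrite !addrA; move: E0; case: (e1) (e2) (e3) => [? ?] [? ?] [? ?] [-> ->].
have dN : (0 <= - det2 e1 e2) = false by apply/negbTE; rewrite -ltNge oppr_lt0.
have dS : (- det2 e1 e2 < 0) = true by rewrite oppr_lt0.
have dF : (det2 e1 e2 < 0) = false by apply/negbTE; rewrite -leNgt ltW.
have rT : circumscale e1 e2 e3 T = det2 e1 e2.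
  rewrite /circumscale !big_cons !big_nil /cone_fst /cone_snd.
  by rewrite !self d21 d31 d32 d13 d23 ?ltxx ?lexx ?dN ?dS ?dF ?(ltW D) /= ?opprK
    ?addr0 ?add0r.
(* The cones contain the ray of their first vector but not that of their second, so [cone_snd]
   vanishes on the edges of the triangle and there are no corner terms. *)
have cT e f : (forall a, a \in T -> cone_snd e f a = 0) -> corners e f T M = 0.
  move=> z; rewrite /corners big_seq big1 // => a /z za.
  apply: big1 => b _; rewrite /corner za mulr0 min_r //.
  by rewrite mulr_ge0 ?cone_fst_ge0 ?cone_snd_ge0.
have := vsum_corners E0 D HT HM; rewrite rT !cT ?addr0 ?mulr0 ?addr0.
- by rewrite mulrCA => /(mulfI (lt0r_neq0 D)).
- move=> a; rewrite !inE => /or3P[]/eqP->; rewrite /cone_snd;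
  by rewrite ?self ?d21 ?d31 ?d32 ?d13 ?d23 ?ltxx ?dN ?dF ?andbF /= ?if_same.
- move=> a; rewrite !inE => /or3P[]/eqP->; rewrite /cone_snd;
  by rewrite ?self ?d21 ?d31 ?d32 ?d13 ?d23 ?ltxx ?dN ?dF ?andbF /= ?if_same.
- move=> a; rewrite !inE => /or3P[]/eqP->; rewrite /cone_snd;
  by rewrite ?self ?d21 ?d31 ?d32 ?d13 ?d23 ?ltxx ?dN ?dF ?andbF /= ?if_same.
Qed.

End Fixed.

End Plucker.

Section Decomposition.
Variable R : realFieldType.
Implicit Types (a b c d e f : R * R) (K L M N : seq (R * R)).

Lemma closed_edges_cons a K : closed_edges (a :: K) <->
  a.1 + \sum_(b <- K) b.1 = 0 /\ a.2 + \sum_(b <- K) b.2 = 0.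
Proof.
rewrite /closed_edges /edge_sum !big_cons /=.
by split => [[-> ->]|[-> ->]].
Qed.

Lemma three_dependent a b c : exists x y z : R,
  [/\ (x, y, z) != (0, 0, 0), x * a.1 + y * b.1 + z * c.1 = 0
    & x * a.2 + y * b.2 + z * c.2 = 0].
Proof.
have [D|D] := eqVneq (det2 a b) 0; last first.
  exists (det2 b c), (det2 c a), (det2 a b); split; rewrite ?xpair_eqE.
  - by rewrite (negbTE D) andbF.
  - by rewrite /det2; ring.
  - by rewrite /det2; ring.
have [a10|a10] := eqVneq a.1 0; last first.
  exists b.1, (- a.1), 0; split; rewrite ?xpair_eqE.
  - by rewrite oppr_eq0 (negbTE a10) andbF.
  - by ring.
  - by rewrite mul0r addr0 mulNr [b.1 * _]mulrC; move: D; rewrite /det2; lra.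
have [a20|a20] := eqVneq a.2 0; last first.
  exists b.2, (- a.2), 0; split; rewrite ?xpair_eqE.
  - by rewrite oppr_eq0 (negbTE a20) andbF.
  - by move: D; rewrite /det2; lra.
  - by ring.
exists 1, 0, 0; split; rewrite ?xpair_eqE ?oner_eq0 // ?a10 ?a20;
by rewrite !mul0r !addr0 mulr0.
Qed.

(** * Reduction to triangles and the inequality for polygons *)

(** [m] is the inverse of the largest of the three numbers: the first time at which one of the
    lengths 1 - m x, 1 - m y, 1 - m z reaches zero, the others being still nonnegative. *)
Lemma first_vanishing (x y z : R) : [|| 0 < x, 0 < y | 0 < z] ->
  exists m, [/\ 0 < m, m * x <= 1, m * y <= 1, m * z <= 1
    & (1 - m * x) * (1 - m * y) * (1 - m * z) = 0].
Proof.
have top (u v w : R) : 0 < u -> v <= u -> w <= u ->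
    exists m, [/\ 0 < m, m * u <= 1, m * v <= 1, m * w <= 1 & 1 - m * u = 0].
  move=> u0 vu wu; exists u^-1; rewrite mulVf ?gt_eqF // invr_gt0 subrr lexx.
  by rewrite !ler_pdivrMl // mulr1.
move=> pos; have [yx|xy] := leP y x; have [zx|xz] := leP z x;
  have [zy|yz] := leP z y.
- have [|m [m0 mu mv mw E]] := top x y z _ yx zx.
    by case/or3P: pos => // h; apply: lt_le_trans h _.
  by exists m; split=> //; rewrite E !mul0r.
- have [|m [m0 mu mv mw E]] := top x y z _ yx zx.
    by case/or3P: pos => // h; apply: lt_le_trans h _.
  by exists m; split=> //; rewrite E !mul0r.
- by have := lt_le_trans xz (le_trans zy yx); rewrite ltxx.
- have [|m [m0 mu mv mw E]] := top z x y _ (ltW xz) (ltW yz).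
    by case/or3P: pos => // h; [apply: lt_trans h _ | apply: lt_trans h _].
  by exists m; split=> //; rewrite E mulr0.
- have [|m [m0 mu mv mw E]] := top y x z _ (ltW xy) zy.
    by case/or3P: pos => // h; [apply: lt_trans h _ | apply: lt_le_trans h _].
  by exists m; split=> //; rewrite E mulr0 mul0r.
- by have := lt_trans xy (lt_le_trans yz zx); rewrite ltxx.
- have [|m [m0 mu mv mw E]] := top y x z _ (ltW xy) zy.
    by case/or3P: pos => // h; [apply: lt_trans h _ | apply: lt_le_trans h _].
  by exists m; split=> //; rewrite E mulr0 mul0r.
- have [|m [m0 mu mv mw E]] := top z x y _ (ltW xz) (ltW yz).
    by case/or3P: pos => // h; [apply: lt_trans h _ | apply: lt_trans h _].
  by exists m; split=> //; rewrite E mulr0.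
Qed.

Variable g : R * R -> R.
Hypothesis g_hom : forall t a, 0 <= t -> g (t * a.1, t * a.2) = t * g a.
Hypothesis g_tri : forall a b c, closed_edges [:: a; b; c] ->
  0 <= g a + g b + g c.

(* Three of the edges are linearly dependent; moving their lengths along a
   dependency, in both directions when its signs differ, until one of them
   vanishes writes the polygon as a positive combination of smaller ones. *)
Lemma closed_edges_sum_ge0 K : closed_edges K -> 0 <= \sum_(a <- K) g a.
Proof.
have g0 : g (0, 0) = 0 by have := g_hom (0, 0) (lexx 0); rewrite !mul0r.
have [n] := ubnP (size K); elim: n K => // n IH K.
case: K => [|a [|b [|c K]]]; rewrite ?big_nil //.
- move=> _ /closed_edges_cons; rewrite !big_nil !addr0 => -[h1 h2].
  by rewrite big_seq1 [a]surjective_pairing h1 h2 g0.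
- move=> _ /closed_edges_cons; rewrite !big_seq1 => -[h1 h2].
  have := g_tri (a := a) (b := b) (c := (0, 0)).
  rewrite g0 addr0 !big_cons big_nil addr0; apply.
  by apply/closed_edges_cons; rewrite !big_cons !big_nil /= !addr0.
rewrite ltnS /= => sK /closed_edges_cons; rewrite !big_cons => -[h1 h2].
have drop x y z : 0 <= x -> 0 <= y -> 0 <= z -> x * y * z = 0 ->
    x * a.1 + y * b.1 + z * c.1 + \sum_(d <- K) d.1 = 0 ->
    x * a.2 + y * b.2 + z * c.2 + \sum_(d <- K) d.2 = 0 ->
    0 <= x * g a + y * g b + z * g c + \sum_(d <- K) g d.
  move=> x0 y0 z0 /eqP; rewrite !mulf_eq0 -orbA => xyz k1 k2.
  have G x' y' (a' b' : R * R) : 0 <= x' -> 0 <= y' ->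
      x' * a'.1 + y' * b'.1 + \sum_(d <- K) d.1 = 0 ->
      x' * a'.2 + y' * b'.2 + \sum_(d <- K) d.2 = 0 ->
      0 <= x' * g a' + y' * g b' + \sum_(d <- K) g d.
    move=> x'0 y'0 l1 l2; rewrite -!g_hom //.
    have := IH [:: (x' * a'.1, x' * a'.2), (y' * b'.1, y' * b'.2) & K].
    rewrite !big_cons addrA; apply; first exact: sK.
    by apply/closed_edges_cons; rewrite !big_cons /= !addrA.
  case/or3P: xyz k1 k2 => /eqP ->; rewrite !mul0r ?add0r ?addr0 => k1 k2; exact: G.
have [x [y [z [nz [e1 [e2 p]]]]]] : exists x y z : R,
    (x, y, z) != (0, 0, 0) /\ (x * a.1 + y * b.1 + z * c.1 = 0 /\
    (x * a.2 + y * b.2 + z * c.2 = 0 /\ [|| 0 < x, 0 < y | 0 < z])).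
  have [x [y [z [nz e1 e2]]]] := three_dependent a b c.
  have [p|] := boolP [|| 0 < x, 0 < y | 0 < z]; first by exists x, y, z.
  rewrite !negb_or -!leNgt => /and3P[x0 y0 z0].
  exists (- x), (- y), (- z); rewrite !mulNr -!opprD e1 e2 oppr0 !oppr_gt0.
  move: nz; rewrite !xpair_eqE !oppr_eq0 !lt_neqAle x0 y0 z0 !andbT => nz.
  by rewrite -!negb_and andbA nz.
have [m [m0 xm ym zm xyzm]] := first_vanishing p.
have [pos|neg] := boolP [&& 0 <= x, 0 <= y & 0 <= z].
  have /and3P[x0 y0 z0] := pos.
  have := g_tri (a := (x * a.1, x * a.2)) (b := (y * b.1, y * b.2))
    (c := (z * c.1, z * c.2)).
  have T : closed_edges [:: (x * a.1, x * a.2); (y * b.1, y * b.2);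
      (z * c.1, z * c.2)].
    by apply/closed_edges_cons; rewrite !big_cons !big_nil /= !addr0 !addrA.
  move=> /(_ T); rewrite !g_hom // => tri.
  have := drop (1 - m * x) (1 - m * y) (1 - m * z).
  rewrite !subr_ge0 => /(_ xm ym zm xyzm).
  have -> : (1 - m * x) * a.1 + (1 - m * y) * b.1 + (1 - m * z) * c.1
     = a.1 + b.1 + c.1 - m * (x * a.1 + y * b.1 + z * c.1) by ring.
  have -> : (1 - m * x) * a.2 + (1 - m * y) * b.2 + (1 - m * z) * c.2
     = a.2 + b.2 + c.2 - m * (x * a.2 + y * b.2 + z * c.2) by ring.
  rewrite e1 e2 mulr0 !subr0 -!addrA h1 h2 => /(_ erefl erefl).
  have := mulr_ge0 (ltW m0) tri; lra.
have [s [s0 xs ys zs xyzs]] : exists s, [/\ 0 < s, s * - x <= 1, s * - y <= 1,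
    s * - z <= 1 & (1 - s * - x) * (1 - s * - y) * (1 - s * - z) = 0].
  by apply: first_vanishing; rewrite !oppr_gt0 !ltNge -!negb_and.
have E (t : R) : (1 - t * x) * a.1 + (1 - t * y) * b.1 + (1 - t * z) * c.1
    + \sum_(d <- K) d.1 = 0 /\
    (1 - t * x) * a.2 + (1 - t * y) * b.2 + (1 - t * z) * c.2
    + \sum_(d <- K) d.2 = 0.
  split.
    have -> : (1 - t * x) * a.1 + (1 - t * y) * b.1 + (1 - t * z) * c.1
      = a.1 + b.1 + c.1 - t * (x * a.1 + y * b.1 + z * c.1) by ring.
    by rewrite e1 mulr0 subr0 -!addrA.
  have -> : (1 - t * x) * a.2 + (1 - t * y) * b.2 + (1 - t * z) * c.2
    = a.2 + b.2 + c.2 - t * (x * a.2 + y * b.2 + z * c.2) by ring.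
  by rewrite e2 mulr0 subr0 -!addrA.
have [E1 E2] := E m; have := drop (1 - m * x) (1 - m * y) (1 - m * z).
rewrite !subr_ge0 => /(_ xm ym zm xyzm E1 E2) F1.
have [] := E (- s); rewrite !mulNr => E3 E4.
have := drop (1 - s * - x) (1 - s * - y) (1 - s * - z).
rewrite !subr_ge0 => /(_ xs ys zs xyzs); rewrite !mulrN => /(_ E3 E4) F2.
(* The displacements [m] and [- s] along the dependency cancel under the weights [s] and [m]. *)
rewrite -(@pmulr_rge0 _ (s + m)) ?addr_gt0 //.
have := mulr_ge0 (ltW s0) F1; have := mulr_ge0 (ltW m0) F2; move: (\sum_(d <- K) _) => S.
lra.
Qed.

End Decomposition.

(** * Segments, and the Plucker inequality for all polygons *)

Section PluckerEdges.
Variable R : realFieldType.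
Implicit Types (a b c d e f : R * R) (K L M N : seq (R * R)).

Lemma half_kernel_plucker e a b c : let same x y := (0 <= det2 e x) == (0 <= det2 e y) in
  half_kernel e a b * (if same a c then `|det2 e c| else 0) <=
  half_kernel e a c * (if same a b then `|det2 e b| else 0)
  + half_kernel e b c * (if same b a then `|det2 e a| else 0).
Proof.
rewrite /half_kernel /=.
have P : `|det2 a b| * `|det2 e c| <= `|det2 a c| * `|det2 e b| + `|det2 b c| * `|det2 e a|.
  rewrite -!normrM; apply: le_trans (ler_normB _ _).
  by rewrite le_eqVlt; apply/orP; left; apply/eqP; congr `| _ |; rewrite /det2; ring.
by case: (0 <= det2 e a); case: (0 <= det2 e b); case: (0 <= det2 e c);
  rewrite /= ?mulr0 ?mul0r ?addr0 ?add0r //; rewrite ?mulr_ge0.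
Qed.

(** The width of the polygon across [e], times the length of [e]; up to a factor, its mixed area
    with a segment parallel to [e]. *)
Definition half_width e M := \sum_(a <- M | 0 <= det2 e a) `|det2 e a|.

(** The signed determinants of a closed polygon sum to zero, so both sides of the line of [e] give
    the same total. *)
Lemma half_widthE e M a : closed_edges M ->
  \sum_(b <- M) (if (0 <= det2 e a) == (0 <= det2 e b) then `|det2 e b| else 0)
  = half_width e M.
Proof.
move=> HM; rewrite -big_mkcond /half_width.
have [h|h] := leP 0 (det2 e a); first by apply: eq_bigl => b; rewrite eq_sym eqb_id.
have S : \sum_(b <- M) det2 e b = 0 by rewrite edge_sum_det2 HM /det2 /= !mulr0 subrr.
rewrite (eq_bigl (fun b => ~~ (0 <= det2 e b))); last first.
  by move=> b; rewrite eq_sym eqbF_neg.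
move: S; rewrite (bigID (fun b => 0 <= det2 e b)) /= => /eqP.
rewrite addr_eq0 => /eqP S.
rewrite [RHS](eq_bigr (fun b => det2 e b)); last by move=> b; exact: ger0_norm.
rewrite S -sumrN; apply: eq_bigr => b; rewrite -ltNge => /ltW; exact: ler0_norm.
Qed.

Lemma sum_half_kernel e M N P : closed_edges P ->
  vsum e M N * half_width e P = \sum_(a <- M) \sum_(b <- N) \sum_(c <- P)
    half_kernel e a b *
    (if (0 <= det2 e a) == (0 <= det2 e c) then `|det2 e c| else 0).
Proof.
move=> HP; rewrite mulr_suml; apply: eq_bigr => a _.
rewrite mulr_suml; apply: eq_bigr => b _.
by rewrite -mulr_sumr half_widthE.
Qed.

Lemma vsum_segment_ineq e L M N : closed_edges L -> closed_edges M ->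
  closed_edges N -> half_width e L * vsum e M N
    <= half_width e M * vsum e L N + half_width e N * vsum e L M.
Proof.
move=> HL HM HN; rewrite ![half_width _ _ * _]mulrC ![vsum e L _]vsumC.
rewrite !sum_half_kernel // addrC.
have -> : forall F : R * R -> R * R -> R * R -> R,
    \sum_(b <- N) \sum_(c <- L) \sum_(a <- M) F b c a
    = \sum_(a <- M) \sum_(b <- N) \sum_(c <- L) F b c a.
  move=> F; rewrite [RHS]exchange_big; apply: eq_bigr => b _.
  exact: exchange_big.
rewrite -big_split /=; apply: ler_sum => a _.
rewrite [X in X + _]exchange_big -big_split /=; apply: ler_sum => b _.
by rewrite -big_split /=; apply: ler_sum => c _; exact: half_kernel_plucker.
Qed.

Lemma vsum_parallel e K : e != (0, 0) -> {in K, forall a, det2 e a = 0} ->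
  exists2 t, 0 <= t & forall M, closed_edges M ->
    vsum e K M = t * half_width e M.
Proof.
case: e => x y e0 Ke.
have q0 : 0 < x ^+ 2 + y ^+ 2.
  rewrite lt_def addr_ge0 ?sqr_ge0 // andbT paddr_eq0 ?sqr_ge0 // !sqrf_eq0.
  by rewrite -xpair_eqE.
exists (\sum_(a <- K) `|x * a.1 + y * a.2| / (x ^+ 2 + y ^+ 2)).
  by apply: sumr_ge0 => a _; rewrite divr_ge0 // ltW.
move=> M HM; rewrite mulr_suml /vsum big_seq [RHS]big_seq.
apply: eq_bigr => a /Ke a0; rewrite -(half_widthE _ a HM) mulr_sumr.
apply: eq_bigr => b _; rewrite /half_kernel a0; case: ifP; rewrite ?mulr0 // => _.
rewrite -[X in _ / X](ger0_norm (ltW q0)) -normfV -!normrM; congr `| _ |.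
apply: (mulIf (lt0r_neq0 q0)).
rewrite mulrAC divfK ?lt0r_neq0 //.
move: a0; rewrite /det2 /= => /eqP; rewrite subr_eq0 => /eqP a0.
have -> : (a.1 * b.2 - a.2 * b.1) * (x ^+ 2 + y ^+ 2)
  = (x * a.1 + y * a.2) * (x * b.2 - y * b.1)
    + (y * a.1 - x * a.2) * (y * b.2 + x * b.1) by ring.
by rewrite a0 subrr mul0r addr0.
Qed.

(** The cut is moved to an edge of [K]. If two edges span the plane, they are ordered so that the
    triangle is positively oriented; otherwise [K] is a segment, or all its edges vanish. *)
Lemma plucker_three c K L M N : (size K = 3)%N -> c != (0, 0) -> closed_edges K ->
  closed_edges L -> closed_edges M -> closed_edges N ->
  vsum c K L * vsum c M N <= vsum c K M * vsum c L N + vsum c K N * vsum c L M.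
Proof.
case: K => [|e1 [|e2 [|e3 []]]] // _ c0 HK HL HM HN.
have cut e : e != (0, 0) ->
    vsum e [:: e1; e2; e3] L * vsum e M N <= vsum e [:: e1; e2; e3] M * vsum e L N
      + vsum e [:: e1; e2; e3] N * vsum e L M ->
    vsum c [:: e1; e2; e3] L * vsum c M N <= vsum c [:: e1; e2; e3] M * vsum c L N
      + vsum c [:: e1; e2; e3] N * vsum c L M.
  by move=> e0; rewrite !(vsum_cut (d := e)).
have S : e1 + e2 + e3 = 0.
  move: HK; rewrite closed_edges_cons !big_cons !big_nil !addr0 !addrA => -[h1 h2].
  by apply/eqP; rewrite [X in X == _]surjective_pairing xpair_eqE /= h1 h2 eqxx.
have nz (x y : R * R) : 0 < det2 x y -> x != (0, 0).
  by apply: contraTneq => ->; rewrite /det2 /= !mul0r subrr ltxx.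
have [D|D|D] := ltgtP (det2 e1 e2) 0.
- have perm P : vsum e2 [:: e1; e2; e3] P = vsum e2 [:: e2; e1; e3] P.
    by rewrite /vsum !big_cons addrCA.
  have D' : 0 < det2 e2 e1 by rewrite det2C oppr_gt0.
  apply: (cut e2); first exact: nz D'.
  have S' : e2 + e1 + e3 = 0 by rewrite [e2 + e1]addrC.
  rewrite !perm !(vsum_triangle S' D') // -!mulrA -mulrDr ler_pM2l //.
  exact: vsum_triangle_ineq.
- apply: (cut e1); first exact: nz D.
  rewrite !(vsum_triangle S D) // -!mulrA -mulrDr ler_pM2l //.
  exact: vsum_triangle_ineq.
have self x : det2 x x = 0 by rewrite /det2; ring.
have par e : e != (0, 0) -> {in [:: e1; e2; e3], forall a, det2 e a = 0} ->
    vsum c [:: e1; e2; e3] L * vsum c M N <= vsum c [:: e1; e2; e3] M * vsum c L N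
      + vsum c [:: e1; e2; e3] N * vsum c L M.
  move=> e0 Ke; apply: (cut e e0).
  have [t t0 tE] := vsum_parallel e0 Ke.
  rewrite !tE // -!mulrA -mulrDr ler_wpM2l //.
  exact: vsum_segment_ineq.
have E3 : e3 = - (e1 + e2) by apply/eqP; rewrite -addr_eq0 addrC S.
have [e10|e10] := eqVneq e1 (0, 0); last first.
  apply: (par e1 e10) => a; rewrite !inE => /or3P[]/eqP-> //.
  by rewrite E3; move: D; rewrite /det2 /=; lra.
have [e20|e20] := eqVneq e2 (0, 0); last first.
  apply: (par e2 e20) => a; rewrite !inE => /or3P[]/eqP-> //.
    by rewrite e10 /det2 /= !mulr0 subrr.
  by rewrite E3 e10 /det2 /=; lra.
have zero P : vsum c [:: e1; e2; e3] P = 0.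
  rewrite /vsum big_seq big1 // => a; rewrite !inE => Ka.
  have -> : a = (0, 0).
    case/or3P: Ka => /eqP-> //.
    by rewrite E3 e10 e20; congr pair; rewrite /= ?addr0 ?oppr0.
  by apply: big1 => b _; rewrite /half_kernel /det2 /= !mul0r subrr normr0 if_same.
by rewrite !zero !mul0r addr0.
Qed.

(** Under a fixed cut, the difference of the two sides is a sum over the edges of [K] of a
    positively homogeneous function [g], so [closed_edges_sum_ge0] reduces it to three edges.
    Homogeneity is limited to factors t >= 0 because the kernel distinguishes the sides of the
    cut. *)
Theorem plucker_edges c K L M N : c != (0, 0) -> closed_edges K ->
  closed_edges L -> closed_edges M -> closed_edges N ->
  vsum c K L * vsum c M N <= vsum c K M * vsum c L N + vsum c K N * vsum c L M.
Proof.
move=> c0 HK HL HM HN; rewrite -subr_ge0.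
pose h P a := \sum_(b <- P) half_kernel c a b.
pose g a := h M a * vsum c L N + h N a * vsum c L M - h L a * vsum c M N.
have vg X : vsum c X M * vsum c L N + vsum c X N * vsum c L M
    - vsum c X L * vsum c M N = \sum_(a <- X) g a.
  by rewrite /g sumrB big_split /= -!mulr_suml.
rewrite vg; apply: closed_edges_sum_ge0 => // [t a t0|a1 a2 a3 H3].
  have hom P : h P (t * a.1, t * a.2) = t * h P a.
    rewrite /h mulr_sumr; apply: eq_bigr => b _; rewrite /half_kernel.
    have dl x : det2 x (t * a.1, t * a.2) = t * det2 x a by rewrite /det2 /=; ring.
    have dr : det2 (t * a.1, t * a.2) b = t * det2 a b by rewrite /det2 /=; ring.
    rewrite dl dr normrM (ger0_norm t0).
    move: t0; rewrite le_eqVlt => /orP[/eqP<-|t0]; first by rewrite !mul0r if_same.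
    by rewrite pmulr_rge0 //; case: ifP; rewrite ?mulr0.
  by rewrite /g !hom; ring.
have := @plucker_three c [:: a1; a2; a3] L M N erefl c0 H3 HL HM HN.
by rewrite -subr_ge0 vg !big_cons big_nil addr0 addrA.
Qed.

End PluckerEdges.

(** * Area of a polygon given by slopes and support numbers *)

Section LowerEnvelope.
Variable R : realType.
Variables (s c : nat -> R) (b : R).
Hypothesis s_lt : forall k, s k < s k.+1.

Fixpoint envelope n x : R :=
  if n is m.+1 then Num.min (envelope m x) (c n + s n * x) else c 0 + s 0 * x.

(* The line of index [k < n] realises [envelope n] on [[brk k.+1, brk k]]. *)
Definition brk k : R :=
  if k is m.+1 then (c m - c m.+1) / (s m.+1 - s m) else b.

Hypothesis brk_le : forall k, brk k.+1 <= brk k.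

Lemma line_cross k x :
  (c k.+1 + s k.+1 * x <= c k + s k * x) = (x <= brk k.+1).
Proof.
rewrite /= ler_pdivlMr ?subr_gt0 // -subr_ge0 -[RHS]subr_ge0.
by congr (0 <= _); ring.
Qed.

Lemma envelope_le_line n x : envelope n x <= c n + s n * x.
Proof. by case: n => [|n] /=; rewrite ?lexx // ge_min lexx orbT. Qed.

Lemma envelope_ltE n x y : (y <= envelope n x) = [forall k : 'I_n.+1, y <= c k + s k * x].
Proof.
elim: n => [|n IH] /=.
  apply/idP/forallP => [h k|/(_ ord0) //]; by rewrite ord1.
rewrite le_min IH; apply/andP/forallP => [[/forallP h1 h2] k|h].
  have [kn|] := ltnP k n.+1; first exact: (h1 (Ordinal kn)).
  move=> nk; have -> : k = n.+1 :> nat by apply/eqP; rewrite eqn_leq nk -ltnS ltn_ord.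
  exact: h2.
split; last exact: (h ord_max).
by apply/forallP => k; have := h (widen_ord (leqnSn _) k).
Qed.

Lemma envelope_left n x : x <= brk n -> envelope n x = c n + s n * x.
Proof.
elim: n => // n IH hx; have hn := le_trans hx (brk_le n).
by rewrite /= IH // min_r // line_cross.
Qed.

Lemma envelope_right n x : brk n.+1 <= x -> envelope n.+1 x = envelope n x.
Proof.
move=> hx; rewrite /= min_l //; apply: le_trans (envelope_le_line n x) _.
by move: hx; rewrite /= ler_pdivrMr ?subr_gt0 //; lra.
Qed.

Lemma continuous_affine (p q : R) : continuous (fun x : R => p + q * x).
Proof.
move=> x; apply: cvgD; first exact: cvg_cst.
by apply: cvgM; [exact: cvg_cst|].
Qed.

Lemma continuous_envelope n : continuous (envelope n).
Proof.
elim: n => [|n IH] x /=.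
  exact: continuous_affine.
apply: continuous_min; first exact: IH.
exact: continuous_affine.
Qed.

Lemma brk_anti j k : (j <= k)%N -> brk k <= brk j.
Proof.
elim: k => [|k IH]; first by rewrite leqn0 => /eqP->.
rewrite leq_eqVlt ltnS => /orP[/eqP->//|/IH].
exact: le_trans (brk_le k).
Qed.

Lemma envelope_b n : envelope n b = c 0 + s 0 * b.
Proof.
elim: n => // n IH; rewrite envelope_right ?IH //; exact: (brk_anti (leq0n n.+1)).
Qed.

Notation mu := (@lebesgue_measure R).

Lemma integral_affine (p q x y : R) : x <= y ->
  \int[mu]_(z in `[x, y]) (p + q * z) = (y - x) * ((p + q * x) + (p + q * y)) / 2.
Proof.
rewrite le_eqVlt => /orP[/eqP<-|xy].
  by rewrite set_itv1 Rintegral_set1 subrr !mul0r.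
have D (z : R) : is_derive z (1 : R) (fun z : R => p * z + q / 2 * (z * z) : R) (p + q * z).
  by apply: is_derive_eq; rewrite -![_ *: _]/(_ * _); field.
have -> : (\int[mu]_(z in `[x, y]) (p + q * z)) =
  fine ((p * y + q / 2 * (y * y))%:E - (p * x + q / 2 * (x * x))%:E)%E.
  congr fine; apply: (@continuous_FTC2 _ (fun z => p + q * z)
    (fun z => p * z + q / 2 * (z * z))) => //.
  - apply: continuous_subspaceT => z.
    exact: continuous_affine.
  - have cF : continuous (fun z : R => p * z + q / 2 * (z * z)).
      by move=> z; apply: differentiable_continuous; apply/derivable1_diffP.
    split.
    + by move=> z _.
    + by apply: cvg_at_right_filter; apply: cF.
    + by apply: cvg_at_left_filter; apply: cF.
  - by move=> z _; rewrite derive1E derive_val.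
by rewrite /=; field.
Qed.

Lemma integrable_envelope n x y :
  mu.-integrable `[x, y] (EFin \o envelope n).
Proof.
apply: continuous_compact_integrable; first exact: segment_compact.
by apply: continuous_subspaceT => z; exact: continuous_envelope.
Qed.

(** Horizontal length of the piece of line [k] in the graph of [envelope n] over [[t, b]]: the last
    piece ends at [t] instead of at a breakpoint. *)
Definition edge n t k : R := if (k < n)%N then brk k - brk k.+1 else brk n - t.

Lemma edge_last n t (k : 'I_n.+1) :
  edge n.+1 t k = edge n (brk n.+1) k.
Proof.
rewrite /edge ltn_ord; case: ltnP => // nk.
by have -> : k = n :> nat by apply/eqP; rewrite eqn_leq nk -ltnS ltn_ord.
Qed.

Lemma edge_ge0 n t k : t <= brk n -> 0 <= edge n t k.
Proof. by move=> tn; rewrite /edge; case: ifP => _; rewrite subr_ge0. Qed.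

Lemma sum_edge n t : \sum_(k < n.+1) edge n t k = b - t.
Proof.
elim: n t => [|n IH] t; first by rewrite big_ord1 /edge ltnn.
rewrite big_ord_recr /= (eq_bigr _ (fun k _ => edge_last t k)) IH.
by rewrite /edge ltnn; lra.
Qed.

Lemma sum_edge_slope n t : t <= brk n ->
  \sum_(k < n.+1) edge n t k * s k = envelope n b - envelope n t.
Proof.
elim: n t => [|n IH] t tn; first by rewrite big_ord1 /edge ltnn /=; ring.
rewrite big_ord_recr /= (eq_bigr (fun k : 'I_n.+1 => edge n (brk n.+1) k * s k));
  last by move=> k _; rewrite edge_last.
rewrite IH // -!/(envelope n.+1 _) !envelope_b (envelope_left tn).
rewrite -(@envelope_right n (brk n.+1)) // (envelope_left (lexx _)).
by rewrite /edge ltnn; ring.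
Qed.

(** The trapezoid under the chord, plus the cap between chord and graph. The cap is half the sum of
    the determinants over unordered pairs of edges, hence a quarter of the sum over ordered
    pairs. *)
Lemma integral_envelope n t : t <= brk n ->
  \int[mu]_(x in `[t, b]) envelope n x =
  (b - t) * (envelope n t + envelope n b) / 2
  + (\sum_(j < n.+1) \sum_(k < n.+1) edge n t j * edge n t k * `|s j - s k|) / 4.
Proof.
elim: n t => [|n IH] t tn.
  by rewrite !big_ord1 subrr normr0 mulr0 mul0r addr0 integral_affine.
set t' := brk n.+1.
have tt' : t <= t' by [].
have t'n : t' <= brk n by exact: brk_le.
have t'b : t' <= b by exact: (brk_anti (leq0n n.+1)).
have := @Rintegral_itvB R (envelope n.+1) (BLeft t) (BRight b) t'
  (integrable_envelope n.+1 t b).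
rewrite !bnd_simp => /(_ tt' t'b) /eqP; rewrite subr_eq => /eqP ->.
rewrite Rintegral_itv_obnd_cbnd; last first.
  by apply: integrableS (integrable_envelope n.+1 t' b) => //;
    exact: subset_itv_oc_cc.
have -> : \int[mu]_(x in `[t', b]) envelope n.+1 x
    = \int[mu]_(x in `[t', b]) envelope n x.
  by apply: eq_Rintegral => x; rewrite inE => /itvP h;
    apply: envelope_right; rewrite h.
rewrite (IH t') //.
have -> : \int[mu]_(x in `[t, t']) envelope n.+1 x
    = \int[mu]_(x in `[t, t']) (c n.+1 + s n.+1 * x).
  by apply: eq_Rintegral => x; rewrite inE => /itvP h;
    apply: envelope_left; rewrite h.
rewrite integral_affine //.
have -> : \sum_(j < n.+2) \sum_(k < n.+2) edge n.+1 t j * edge n.+1 t k * `|s j - s k|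
  = \sum_(j < n.+1) \sum_(k < n.+1) edge n t' j * edge n t' k * `|s j - s k|
    + 2 * ((t' - t) * (s n.+1 * (b - t') - (envelope n b - envelope n t'))).
  have L k : (k <= n)%N -> s k <= s n.+1.
    move=> kn; apply: ltW; have := ltn_ord (Ordinal (kn : (k < n.+1)%N)) => /=.
    elim: n.+1 => // m IHm; rewrite ltnS leq_eqVlt => /orP[/eqP->//|/IHm h].
    exact: lt_trans (s_lt m).
  pose D := edge n.+1 t n.+1.
  have DE : D = t' - t by rewrite /D /edge ltnn.
  (* The new slope is the largest, so the absolute values in the pairs with the new edge open up and
     their sum telescopes. *)
  have cross : \sum_(k < n.+1) edge n t' k * (s n.+1 - s k)
      = s n.+1 * (b - t') - (envelope n b - envelope n t').
    rewrite -(@sum_edge n t') -sum_edge_slope //.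
    rewrite mulr_sumr -sumrB; apply: eq_bigr => k _; ring.
  rewrite big_ord_recr /= [X in _ + X = _]big_ord_recr /= -/D subrr normr0 mulr0 addr0.
  rewrite (eq_bigr (fun j : 'I_n.+1 => \sum_(k < n.+1)
      edge n t' j * edge n t' k * `|s j - s k|
      + D * (edge n t' j * (s n.+1 - s j)))); last first.
    move=> j _; rewrite big_ord_recr /= -/D edge_last; congr (_ + _).
      by apply: eq_bigr => k _; rewrite edge_last.
    by rewrite distrC ger0_norm ?subr_ge0 ?L -1?ltnS //; ring.
  rewrite big_split /= -mulr_sumr cross -addrA; congr (_ + _).
  rewrite (eq_bigr (fun k : 'I_n.+1 => D * (edge n t' k * (s n.+1 - s k)))).
    by rewrite -mulr_sumr cross DE; ring.
  move=> k _; rewrite -/D edge_last ger0_norm ?subr_ge0 ?L -1?ltnS //; ring.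
have e1 : envelope n.+1 t = c n.+1 + s n.+1 * t by exact: envelope_left.
have e2 : envelope n t' = c n.+1 + s n.+1 * t'.
  by rewrite -envelope_right // envelope_left.
by rewrite e1 e2 !envelope_b; field.
Qed.

End LowerEnvelope.

(** * Polygons circumscribed with prescribed slopes *)

Definition sublinear (R : realType) (h : R * R -> R) : Prop :=
  (forall u v, h (u.1 + v.1, u.2 + v.2) <= h u + h v) /\
  (forall t u, 0 <= t -> h (t * u.1, t * u.2) = t * h u).

Section Polygon.
Variable R : realType.
Variables (s : nat -> R) (n : nat).
Hypothesis s_lt : forall k, s k < s k.+1.
Implicit Type h : R * R -> R.

Definition xmax h := h (1, 0).
Definition xmin h := - h (-1, 0).
(** The support number in the direction of the upper normal of a line of slope [s k], that is, the
    intercept of the supporting line of this slope from above. *)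
Definition upper h k := h (- s k, 1).
Definition lower h k := h (- s k, -1).

(* The lower boundary is described by its mirror image, so its slopes are the
   [- s k]. *)
Definition polygon h : set (R * R) :=
  [set z | (xmin h <= z.1 <= xmax h) /\ forall k, (k <= n)%N ->
    z.2 <= upper h k + s k * z.1 /\ - z.2 <= lower h k + s k * z.1].

Section Sublinear.
Variable h : R * R -> R.
Hypothesis hS : sublinear h.

Lemma sublinearD x y z t : h (x + z, y + t) <= h (x, y) + h (z, t).
Proof. by have := hS.1 (x, y) (z, t). Qed.

Lemma sublinearZ t x y : 0 <= t -> h (t * x, t * y) = t * h (x, y).
Proof. by have := hS.2 t (x, y). Qed.

Lemma xmin_le_xmax : xmin h <= xmax h.
Proof.
rewrite /xmin /xmax; have := sublinearD 1 0 (-1) 0.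
have := sublinearZ 0 0 (lexx 0); rewrite !mul0r subrr addr0 => ->; lra.
Qed.

Section Chain.
Variable e : R.

Let c k := h (- s k, e).

(** The normal (- s k.+1, e) is a positive combination of its two neighbours, so by subadditivity no
    line is hidden behind the others. For the first breakpoint, one neighbour is (1, 0). The upper
    chain has [e] = 1, the lower one [e] = -1. *)
Lemma sublinear_brk_le k : brk s c (xmax h) k.+1 <= brk s c (xmax h) k.
Proof.
have ds j : 0 < s j.+1 - s j by rewrite subr_gt0.
have ds' j : 0 <= s j.+1 - s j by exact: ltW.
case: k => [|k] /=.
  rewrite ler_pdivrMr // /c /xmax.
  have := sublinearD (- s 1%N) e ((s 1%N - s 0%N) * 1) ((s 1%N - s 0%N) * 0).
  rewrite sublinearZ // mulr1 mulr0 addr0.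
  have -> : - s 1%N + (s 1%N - s 0%N) = - s 0%N by ring.
  lra.
rewrite ler_pdivrMr // mulrAC ler_pdivlMr // /c.
have := sublinearD ((s k.+2 - s k.+1) * - s k) ((s k.+2 - s k.+1) * e)
  ((s k.+1 - s k) * - s k.+2) ((s k.+1 - s k) * e).
rewrite !sublinearZ //.
have -> : (s k.+2 - s k.+1) * - s k + (s k.+1 - s k) * - s k.+2
  = (s k.+2 - s k) * - s k.+1 by ring.
have -> : (s k.+2 - s k.+1) * e + (s k.+1 - s k) * e
  = (s k.+2 - s k) * e by ring.
rewrite sublinearZ; last by have := ds k; have := ds k.+1; lra.
lra.
Qed.

Lemma xmin_le_brk k : xmin h <= brk s c (xmax h) k.
Proof.
case: k => [|k] /=; first exact: xmin_le_xmax.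
have ds : 0 < s k.+1 - s k by rewrite subr_gt0.
have ds' := ltW ds.
rewrite ler_pdivlMr // /c /xmin.
have := sublinearD (- s k) e ((s k.+1 - s k) * -1) ((s k.+1 - s k) * 0).
rewrite sublinearZ // mulr0 addr0.
have -> : - s k + (s k.+1 - s k) * -1 = - s k.+1 by ring.
lra.
Qed.

End Chain.

Let U := envelope s (upper h) n.
Let L := envelope s (lower h) n.

(** An upper and a lower normal add up to a multiple of (1, 0) or of (-1, 0), where [h] is known
    through [xmax] and [xmin]. *)
Lemma envelope_sum_ge0 x : xmin h <= x <= xmax h -> 0 <= U x + L x.
Proof.
move=> /andP[ax xb]; suff : - L x <= U x by lra.
rewrite /U envelope_ltE; apply/forallP => k; rewrite lerNl /L envelope_ltE.
apply/forallP => j; rewrite /upper /lower.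
have := sublinearD (- s k) 1 (- s j) (-1); rewrite subrr.
have [sk|sk] := leP 0 (s k + s j).
  have := sublinearZ (-1) 0 sk; rewrite mulr0.
  have -> : (s k + s j) * -1 = - s k - s j by ring.
  move=> ->; have : 0 <= (s k + s j) * (x - xmin h) by rewrite mulr_ge0 ?subr_ge0.
  by rewrite /xmin; lra.
have sk' : 0 <= - (s k + s j) by rewrite oppr_ge0 ltW.
have := sublinearZ 1 0 sk'; rewrite mulr0 mulr1 opprD => ->.
have : 0 <= - (s k + s j) * (xmax h - x) by rewrite mulr_ge0 ?subr_ge0.
by rewrite /xmax; lra.
Qed.

Lemma polygonE : polygon h =
  [set z | z.1 \in `[xmin h, xmax h] /\ z.2 \in `[- L z.1, U z.1]].
Proof.
apply/seteqP; split=> -[x y] /=; rewrite !in_itv /=.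
  move=> [xab K]; split=> //; apply/andP; split.
    rewrite lerNl /L envelope_ltE; apply/forallP => k.
    by case: (K k _); rewrite // -ltnS ltn_ord.
  rewrite /U envelope_ltE; apply/forallP => k.
  by case: (K k _); rewrite // -ltnS ltn_ord.
move=> [xab /andP[h1 h2]]; split=> // k kn.
split; first by move: h2; rewrite /U envelope_ltE => /forallP/(_ (Ordinal (kn : (k < n.+1)%N))).
by move: h1; rewrite lerNl /L envelope_ltE => /forallP/(_ (Ordinal (kn : (k < n.+1)%N))).
Qed.

Lemma xsection_polygon x : xsection (polygon h) x =
  if x \in `[xmin h, xmax h] then `[- L x, U x]%classic else set0.
Proof.
rewrite polygonE; apply/seteqP; split=> y; rewrite /xsection /= inE /=.
  by case=> ->.
by case: ifP.
Qed.

Lemma measurable_polygon : measurable (polygon h).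
Proof.
have -> : polygon h = [set z | xmin h <= z.1] `&` ([set z | z.1 <= xmax h] `&`
    ([set z | z.2 - U z.1 <= 0] `&` [set z | - z.2 - L z.1 <= 0])).
  rewrite polygonE; apply/seteqP; split=> -[x y] /=; rewrite !in_itv /=.
    by move=> [/andP[? ?] /andP[? ?]]; do !split => //; rewrite subr_le0 // lerNl.
  by rewrite !subr_le0 => -[-> [-> [-> h4]]]; rewrite lerNl h4.
have mU : measurable_fun setT U.
  by apply: continuous_measurable_fun; exact: continuous_envelope.
have mL : measurable_fun setT L.
  by apply: continuous_measurable_fun; exact: continuous_envelope.
have m1 (f : R * R -> R) (I : interval R) : measurable_fun setT f ->
    measurable (f @^-1` [set` I]).
  by move=> mf; rewrite -[_ @^-1` _]setTI; exact: mf.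
apply: measurableI; last apply: measurableI; last apply: measurableI.
- have -> : [set z : R * R | xmin h <= z.1] = fst @^-1` `[xmin h, +oo[%classic.
    by apply/seteqP; split=> z /=; rewrite in_itv /= andbT.
  by apply: m1; exact: measurable_fst.
- have -> : [set z : R * R | z.1 <= xmax h] = fst @^-1` `]-oo, xmax h]%classic.
    by apply/seteqP; split=> z /=; rewrite in_itv.
  by apply: m1; exact: measurable_fst.
- have -> : [set z : R * R | z.2 - U z.1 <= 0]
      = (fun z : R * R => z.2 - U z.1) @^-1` `]-oo, 0]%classic.
    by apply/seteqP; split=> z /=; rewrite in_itv.
  apply: m1; apply: measurable_funB; first exact: measurable_snd.
  exact: (measurableT_comp mU measurable_fst).
- have -> : [set z : R * R | - z.2 - L z.1 <= 0]
      = (fun z : R * R => - z.2 - L z.1) @^-1` `]-oo, 0]%classic.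
    by apply/seteqP; split=> z /=; rewrite in_itv.
  apply: m1; apply: measurable_funB.
    by apply: measurableT_comp => //; exact: measurable_snd.
  exact: (measurableT_comp mL measurable_fst).
Qed.

Notation mu := (@lebesgue_measure R).

Lemma area_polygon_integral : area (polygon h) =
  (\int[mu]_(x in `[xmin h, xmax h]) (U x + L x)%:E)%E.
Proof.
rewrite /area /product_measure1 [RHS]integral_mkcond /=.
apply: eq_integral => x _; rewrite /= xsection_polygon patchE mem_setE.
case: ifP => [xab|_]; last by rewrite measure0.
have := envelope_sum_ge0 xab => UL.
rewrite lebesgue_measure_itv /= lte_fin.
case: ltP => [_|]; first by rewrite -EFinB opprK.
by move=> le; congr EFin; apply/eqP; rewrite eq_le UL /=; lra.
Qed.

Lemma area_polygon : area (polygon h) =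
  ((xmax h - xmin h) * (U (xmin h) + U (xmax h) + L (xmin h) + L (xmax h)) / 2
  + (\sum_(j < n.+1) \sum_(k < n.+1) edge s (upper h) (xmax h) n (xmin h) j
      * edge s (upper h) (xmax h) n (xmin h) k * `|s j - s k|
   + \sum_(j < n.+1) \sum_(k < n.+1) edge s (lower h) (xmax h) n (xmin h) j
      * edge s (lower h) (xmax h) n (xmin h) k * `|s j - s k|) / 4)%:E.
Proof.
have iU := integrable_envelope s (upper h) n (xmin h) (xmax h).
have iL := integrable_envelope s (lower h) n (xmin h) (xmax h).
rewrite area_polygon_integral.
under eq_integral do rewrite EFinD.
rewrite integralD_EFin //.
rewrite -[X in (X + _)%E]fineK ?integrable_fin_num //.
rewrite -[X in (_ + X)%E]fineK ?integrable_fin_num // -EFinD.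
have := integral_envelope s_lt (sublinear_brk_le 1) (xmin_le_brk 1 n).
have := integral_envelope s_lt (sublinear_brk_le (-1)) (xmin_le_brk (-1) n).
by rewrite /Rintegral => -> ->; congr EFin; rewrite /U /L; field.
Qed.

End Sublinear.
End Polygon.

(** * The circumscribed polygons as lists of edges *)

Section PolygonEdges.
Variable R : realType.
Variables (s : nat -> R) (n : nat).
Hypothesis s_lt : forall k, s k < s k.+1.
Implicit Type h : R * R -> R.

Definition upper_edge h k := edge s (upper s h) (xmax h) n (xmin h) k.
Definition lower_edge h k := edge s (lower s h) (xmax h) n (xmin h) k.
Definition right_edge h :=
  upper s h 0 + s 0%N * xmax h + (lower s h 0 + s 0%N * xmax h).
Definition left_edge h :=
  upper s h n + s n * xmin h + (lower s h n + s n * xmin h).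

(** Edge vectors of a counterclockwise boundary: the upper chain runs to the left, the lower one, of
    slopes [- s k], to the right; the right side goes up and the left side down. *)
Definition polygon_edges h : seq (R * R) :=
  [seq (- upper_edge h k, - (s k * upper_edge h k)) | k <- index_iota 0 n.+1]
  ++ ([seq (lower_edge h k, - (s k * lower_edge h k)) | k <- index_iota 0 n.+1]
  ++ [:: (0, right_edge h); (0, - left_edge h)]).

(** Four times the mixed area, as the polarization of [area_polygon]: the last two lines pair the
    vertical sides of one polygon with the width of the other. *)
Definition polygon_form h g : R :=
  \sum_(j < n.+1) \sum_(k < n.+1)
    upper_edge h j * upper_edge g k * `|s j - s k|
  + \sum_(j < n.+1) \sum_(k < n.+1)
    lower_edge h j * lower_edge g k * `|s j - s k|
  + (xmax h - xmin h) * (right_edge g + left_edge g)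
  + (xmax g - xmin g) * (right_edge h + left_edge h).

Lemma envelope_ends h : sublinear h ->
  [/\ envelope s (upper s h) n (xmax h) = upper s h 0 + s 0%N * xmax h,
      envelope s (lower s h) n (xmax h) = lower s h 0 + s 0%N * xmax h,
      envelope s (upper s h) n (xmin h) = upper s h n + s n * xmin h
    & envelope s (lower s h) n (xmin h) = lower s h n + s n * xmin h].
Proof.
move=> hS; split.
- exact: (envelope_b s_lt (sublinear_brk_le s_lt hS 1)).
- exact: (envelope_b s_lt (sublinear_brk_le s_lt hS (-1))).
- exact: (envelope_left s_lt (sublinear_brk_le s_lt hS 1) (xmin_le_brk s_lt hS 1 n)).
- exact: (envelope_left s_lt (sublinear_brk_le s_lt hS (-1)) (xmin_le_brk s_lt hS (-1) n)).
Qed.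

Lemma area_polygon_form h : sublinear h ->
  area (polygon s n h) = (polygon_form h h / 4)%:E.
Proof.
move=> hS; rewrite area_polygon //; congr EFin.
have [-> -> -> ->] := envelope_ends hS.
by rewrite /polygon_form /right_edge /left_edge; field.
Qed.

Lemma upper_edgeD h g k : upper_edge (fun u => h u + g u) k
  = upper_edge h k + upper_edge g k.
Proof.
rewrite /upper_edge /edge.
have D j : brk s (upper s (fun u => h u + g u)) (xmax (fun u => h u + g u)) j
  = brk s (upper s h) (xmax h) j + brk s (upper s g) (xmax g) j.
  by case: j => [|j] //=; rewrite -mulrDl /upper; congr (_ / _); ring.
by case: ifP => _; rewrite !D /xmin; ring.
Qed.

Lemma lower_edgeD h g k : lower_edge (fun u => h u + g u) k
  = lower_edge h k + lower_edge g k.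
Proof.
rewrite /lower_edge /edge.
have D j : brk s (lower s (fun u => h u + g u)) (xmax (fun u => h u + g u)) j
  = brk s (lower s h) (xmax h) j + brk s (lower s g) (xmax g) j.
  by case: j => [|j] //=; rewrite -mulrDl /lower; congr (_ / _); ring.
by case: ifP => _; rewrite !D /xmin; ring.
Qed.

Lemma polygon_formD h g :
  polygon_form (fun u => h u + g u) (fun u => h u + g u)
  = polygon_form h h + 2 * polygon_form h g + polygon_form g g.
Proof.
have S (p q : nat -> R) :
   \sum_(j < n.+1) \sum_(k < n.+1) (p j + q j) * (p k + q k) * `|s j - s k|
   = \sum_(j < n.+1) \sum_(k < n.+1) p j * p k * `|s j - s k|
   + 2 * (\sum_(j < n.+1) \sum_(k < n.+1) p j * q k * `|s j - s k|)
   + \sum_(j < n.+1) \sum_(k < n.+1) q j * q k * `|s j - s k|.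
  have -> : \sum_(j < n.+1) \sum_(k < n.+1) (p j + q j) * (p k + q k) * `|s j - s k|
   = \sum_(j < n.+1) \sum_(k < n.+1) p j * p k * `|s j - s k|
   + \sum_(j < n.+1) \sum_(k < n.+1) p j * q k * `|s j - s k|
   + \sum_(j < n.+1) \sum_(k < n.+1) p k * q j * `|s k - s j|
   + \sum_(j < n.+1) \sum_(k < n.+1) q j * q k * `|s j - s k|.
    rewrite -!big_split /=; apply: eq_bigr => j _; rewrite -!big_split /=.
    by apply: eq_bigr => k _; rewrite (distrC (s k)); ring.
  rewrite [X in _ + _ + X + _]exchange_big /=.
  ring.
rewrite /polygon_form.
under eq_bigr do under eq_bigr do rewrite !upper_edgeD.
rewrite S.
under [X in _ + X + _ + _]eq_bigr do under eq_bigr do rewrite !lower_edgeD.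
rewrite S /right_edge /left_edge /upper /lower /xmax /xmin; ring.
Qed.

Lemma right_edge_ge0 h : sublinear h -> 0 <= right_edge h.
Proof.
move=> hS; have := @envelope_sum_ge0 R s n h hS (xmax h).
by have [-> -> _ _] := envelope_ends hS; rewrite lexx xmin_le_xmax //; apply.
Qed.

Lemma left_edge_ge0 h : sublinear h -> 0 <= left_edge h.
Proof.
move=> hS; have := @envelope_sum_ge0 R s n h hS (xmin h).
by have [_ _ -> ->] := envelope_ends hS; rewrite lexx xmin_le_xmax //; apply.
Qed.

Lemma upper_edge_ge0 h k : sublinear h -> 0 <= upper_edge h k.
Proof.
by move=> hS; apply: edge_ge0; [exact: sublinear_brk_le | exact: xmin_le_brk].
Qed.

Lemma lower_edge_ge0 h k : sublinear h -> 0 <= lower_edge h k.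
Proof.
by move=> hS; apply: edge_ge0; [exact: sublinear_brk_le | exact: xmin_le_brk].
Qed.

Lemma sum_upper_edge h : \sum_(k < n.+1) upper_edge h k = xmax h - xmin h.
Proof. exact: sum_edge. Qed.

Lemma sum_lower_edge h : \sum_(k < n.+1) lower_edge h k = xmax h - xmin h.
Proof. exact: sum_edge. Qed.

Lemma closed_polygon_edges h : sublinear h -> closed_edges (polygon_edges h).
Proof.
move=> hS; rewrite /closed_edges /edge_sum /polygon_edges !big_cat !big_map /=.
rewrite !big_mkord !big_cons !big_nil /=; congr pair.
  by rewrite sumrN sum_upper_edge sum_lower_edge; ring.
rewrite !sumrN.
have -> : \sum_(k < n.+1) s k * upper_edge h k
  = \sum_(k < n.+1) upper_edge h k * s k by apply: eq_bigr => k _; exact: mulrC.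
have -> : \sum_(k < n.+1) s k * lower_edge h k
  = \sum_(k < n.+1) lower_edge h k * s k by apply: eq_bigr => k _; exact: mulrC.
rewrite (sum_edge_slope s_lt (sublinear_brk_le s_lt hS 1) (xmin_le_brk s_lt hS 1 n)).
rewrite (sum_edge_slope s_lt (sublinear_brk_le s_lt hS (-1)) (xmin_le_brk s_lt hS (-1) n)).
have [-> -> -> ->] := envelope_ends hS.
by rewrite /right_edge /left_edge; ring.
Qed.

Lemma vsum_cat (c : R * R) (K L M : seq (R * R)) :
  vsum c (K ++ L) M = vsum c K M + vsum c L M.
Proof. exact: big_cat. Qed.

Lemma vsum_catr (c : R * R) (K L M : seq (R * R)) :
  vsum c K (L ++ M) = vsum c K L + vsum c K M.
Proof. by rewrite ![vsum c K _]vsumC vsum_cat. Qed.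

Lemma vertical_kernelE (a b : R * R) : half_kernel (0, -1) a b =
  if (0 <= a.1) == (0 <= b.1) then `|a.1 * b.2 - a.2 * b.1| else 0.
Proof. by rewrite /half_kernel /det2 /= !mul0r !mulN1r !sub0r !opprK. Qed.

(** The vertical cut separates the upper chain from the lower one. The vertical sides lie on the cut
    and are counted with the lower chain, where they meet the whole width. So are upper edges of
    length zero, for which the kernel vanishes anyway. *)
Lemma vsum_polygon_edges h g : sublinear h -> sublinear g ->
  vsum (0, -1) (polygon_edges h) (polygon_edges g) = polygon_form h g.
Proof.
move=> hS gS; rewrite /polygon_edges.
set uh := [seq _ | k <- _]; set lh := [seq _ | k <- _].
set ug := [seq _ | k <- _]; set lg := [seq _ | k <- _].
have up0 (w : R) : 0 <= w -> (0 <= - w) = (w == 0).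
  by move=> w0; rewrite oppr_ge0 eq_le w0 andbT.
have uu : vsum (0, -1) uh ug = \sum_(j < n.+1) \sum_(k < n.+1)
    upper_edge h j * upper_edge g k * `|s j - s k|.
  rewrite /vsum big_map big_mkord; apply: eq_bigr => j _.
  rewrite big_map big_mkord; apply: eq_bigr => k _.
  have := upper_edge_ge0 j hS; have := upper_edge_ge0 k gS.
  rewrite vertical_kernelE /=; move: (upper_edge _ _) (upper_edge _ _) => w v v0 w0.
  rewrite !up0 //.
  have [->|wN] := eqVneq w 0; first by rewrite !(mul0r, mulr0, oppr0, addr0) normr0 if_same.
  have [->|vN] := eqVneq v 0; first by rewrite !(mul0r, mulr0, oppr0, addr0) normr0.
  rewrite eqxx -[w * v]ger0_norm ?mulr_ge0 // -normrM -normrN; congr `| _ |; ring.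
have ll : vsum (0, -1) lh lg = \sum_(j < n.+1) \sum_(k < n.+1)
    lower_edge h j * lower_edge g k * `|s j - s k|.
  rewrite /vsum big_map big_mkord; apply: eq_bigr => j _.
  rewrite big_map big_mkord; apply: eq_bigr => k _.
  have := lower_edge_ge0 j hS; have := lower_edge_ge0 k gS.
  rewrite vertical_kernelE /=; move: (lower_edge _ _) (lower_edge _ _) => w v v0 w0.
  rewrite v0 w0 eqxx -[w * v]ger0_norm ?mulr_ge0 // -normrM; congr `| _ |; ring.
have off (a b : R * R) : b.1 >= 0 -> (a.1 < 0 \/ a = (0, 0)) -> half_kernel (0, -1) a b = 0.
  move=> b0 [a0|->]; rewrite vertical_kernelE b0.
    by rewrite leNgt a0.
  by rewrite /= !mul0r subrr normr0 if_same.
have upE f k : sublinear f -> let a := (- upper_edge f k, - (s k * upper_edge f k)) in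
    a.1 < 0 \/ a = (0, 0).
  move=> fS /=; have := upper_edge_ge0 k fS; rewrite le_eqVlt => /orP[/eqP <-|k0].
    by right; rewrite mulr0 oppr0.
  by left; rewrite oppr_lt0.
have vertical_ge0 (f : R * R -> R) (b : R * R) : b \in [:: (0, right_edge f); (0, - left_edge f)] ->
    0 <= b.1 by rewrite !inE => /orP[]/eqP->.
have ul M : (forall b, b \in M -> 0 <= b.1) -> vsum (0, -1) uh M = 0.
  move=> M0; rewrite /vsum big_map big1 // => k _; rewrite big_seq big1 // => b bM.
  by apply: off; [exact: M0 | exact: upE].
have lu M : (forall b, b \in M -> 0 <= b.1) -> vsum (0, -1) M ug = 0.
  move=> M0; rewrite vsumC /vsum big_map big1 // => k _; rewrite big_seq big1 // => b bM.
  by apply: off; [exact: M0 | exact: upE].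
have lhP b : b \in lh -> 0 <= b.1.
  by case/mapP => k _ ->; exact: lower_edge_ge0.
have lgP b : b \in lg -> 0 <= b.1.
  by case/mapP => k _ ->; exact: lower_edge_ge0.
have lv f g' : sublinear f -> sublinear g' ->
  vsum (0, -1) [seq (lower_edge f k, - (s k * lower_edge f k)) | k <- index_iota 0 n.+1]
   [:: (0, right_edge g'); (0, - left_edge g')]
   = (xmax f - xmin f) * (right_edge g' + left_edge g').
  move=> fS gS'; rewrite /vsum big_map big_mkord -sum_lower_edge mulr_suml.
  apply: eq_bigr => k _; rewrite !big_cons big_nil addr0 !vertical_kernelE /=.
  rewrite lower_edge_ge0 // lexx eqxx !mulr0 !subr0 mulrN normrN.
  by rewrite !ger0_norm ?mulr_ge0 ?lower_edge_ge0 ?right_edge_ge0 ?left_edge_ge0 // -mulrDr.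
have vv : vsum (0, -1) [:: (0, right_edge h); (0, - left_edge h)]
   [:: (0, right_edge g); (0, - left_edge g)] = 0.
  rewrite /vsum big_seq big1 // => a; rewrite !inE => ha; rewrite big_seq big1 // => b.
  rewrite !inE vertical_kernelE => hb.
  have [a0 b0] : a.1 = 0 /\ b.1 = 0.
    by case/orP: ha => /eqP->; case/orP: hb => /eqP->.
  by rewrite a0 b0 mul0r mulr0 subrr normr0 if_same.
rewrite !vsum_cat !vsum_catr uu ll vv.
rewrite (ul lg) // (ul [:: _; _]); last exact: vertical_ge0.
rewrite (lu lh) // (lu [:: _; _]); last exact: vertical_ge0.
rewrite lv // [vsum _ [:: _; _] lg]vsumC lv // /polygon_form; ring.
Qed.

End PolygonEdges.

(** * Approximation of convex bodies *)

Section Support.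
Variable R : realType.
Implicit Types (K L : set (R * R)) (u z : R * R).

Definition dot2 u z : R := u.1 * z.1 + u.2 * z.2.

Definition supp K u : R := sup [set dot2 u z | z in K].

Lemma continuous_dot2 u : continuous (dot2 u).
Proof.
move=> z; apply: cvgD; apply: cvgM; try exact: cvg_cst.
  exact: cvg_fst.
exact: cvg_snd.
Qed.

Lemma compact_max K (f : R * R -> R) : K !=set0 -> compact K -> continuous f ->
  exists2 p, K p & forall z, K z -> f z <= f p.
Proof.
move=> K0 cK cf.
have [|p pK pmax] := @compact_EVT_max _ _ f K K0 cK; first exact: continuous_subspaceT.
by exists p; [rewrite inE in pK | move=> z Kz; apply: pmax; rewrite inE].
Qed.

Lemma suppP K u : convex_body2 K ->
  exists2 p, K p & supp K u = dot2 u p /\ forall z, K z -> dot2 u z <= supp K u.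
Proof.
move=> [K0 [cK _]]; have [p Kp pmax] := compact_max K0 cK (@continuous_dot2 u).
have E : supp K u = dot2 u p.
  apply/eqP; rewrite eq_le; apply/andP; split.
    apply: ge_sup; first by exists (dot2 u p), p.
    by move=> _ [z Kz <-]; exact: pmax.
  apply: ub_le_sup; last by exists p.
  by exists (dot2 u p) => _ [z Kz <-]; exact: pmax.
by exists p => //; rewrite E.
Qed.

Lemma sublinear_supp K : convex_body2 K -> sublinear (supp K).
Proof.
move=> HK; split=> [u v|t u t0].
  have [p Kp [-> _]] := suppP (u.1 + v.1, u.2 + v.2) HK.
  have [_ _ [_ /(_ p Kp) hu]] := suppP u HK; have [_ _ [_ /(_ p Kp) hv]] := suppP v HK.
  by move: hu hv; rewrite /dot2 /=; lra.
have [p Kp [pE pmax]] := suppP (t * u.1, t * u.2) HK.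
have [q Kq [qE qmax]] := suppP u HK.
have dZ z : dot2 (t * u.1, t * u.2) z = t * dot2 u z by rewrite /dot2 /=; ring.
apply/eqP; rewrite eq_le; apply/andP; split.
  by rewrite pE dZ ler_wpM2l // qmax.
by rewrite qE -dZ pmax.
Qed.

Lemma convex_body_msum K L : convex_body2 K -> convex_body2 L ->
  convex_body2 (msum K L).
Proof.
move=> [[x Kx] [cK vK]] [[y Ly] [cL vL]]; split; last split.
- by exists (x.1 + y.1, x.2 + y.2), x => //; exists y.
- have -> : msum K L = (fun p : (R * R) * (R * R) =>
      (p.1.1 + p.2.1, p.1.2 + p.2.2)) @` (K `*` L).
    apply/seteqP; split=> [z [a Ka [b Lb ->]]|z [[a b] [/= Ka Lb] <-]].
      by exists (a, b).
    by exists a => //; exists b.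
  apply: continuous_compact; last exact: compact_setX.
  apply: continuous_subspaceT => p.
  have c1 : {for p, continuous (fun p : (R * R) * (R * R) => p.1.1)}.
    by apply: (@continuous_comp _ _ _ fst fst); exact: cvg_fst.
  have c2 : {for p, continuous (fun p : (R * R) * (R * R) => p.2.1)}.
    by apply: (@continuous_comp _ _ _ snd fst); [exact: cvg_snd | exact: cvg_fst].
  have c3 : {for p, continuous (fun p : (R * R) * (R * R) => p.1.2)}.
    by apply: (@continuous_comp _ _ _ fst snd); [exact: cvg_fst | exact: cvg_snd].
  have c4 : {for p, continuous (fun p : (R * R) * (R * R) => p.2.2)}.
    by apply: (@continuous_comp _ _ _ snd snd); exact: cvg_snd.
  exact: (cvg_pair (cvgD c1 c2) (cvgD c3 c4)).
- move=> _ _ [a Ka [b Lb ->]] [a' Ka' [b' Lb' ->]] t t01 /=.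
  exists (t * a.1 + (1 - t) * a'.1, t * a.2 + (1 - t) * a'.2); first exact: vK.
  exists (t * b.1 + (1 - t) * b'.1, t * b.2 + (1 - t) * b'.2); first exact: vL.
  by congr pair => /=; ring.
Qed.

Lemma supp_msum K L : convex_body2 K -> convex_body2 L ->
  supp (msum K L) = fun u => supp K u + supp L u.
Proof.
move=> HK HL; apply/funext => u.
have [_ [a Ka [b Lb ->]] [E rM]] := suppP u (convex_body_msum HK HL).
have dD x y : dot2 u (x.1 + y.1, x.2 + y.2) = dot2 u x + dot2 u y.
  by rewrite /dot2 /=; ring.
have [p Kp [pE pM]] := suppP u HK; have [q Lq [qE qM]] := suppP u HL.
apply/eqP; rewrite eq_le; apply/andP; split; first by rewrite E dD lerD ?pM ?qM.
by rewrite pE qE -dD; apply: rM; exists p => //; exists q.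
Qed.

(* First-order optimality of the point [p] of [K] nearest to [q]. *)
Lemma separation K q : convex_body2 K -> ~ K q -> exists u, supp K u < dot2 u q.
Proof.
move=> HK Kq; have [K0 [cK vK]] := HK.
pose f z : R := - ((z.1 - q.1) * (z.1 - q.1) + (z.2 - q.2) * (z.2 - q.2)).
have cf : continuous f.
  move=> z; apply: cvgN; apply: cvgD; apply: cvgM;
  by apply: cvgB; try exact: cvg_cst; first [exact: cvg_fst | exact: cvg_snd].
have [p Kp pmax] := compact_max K0 cK cf.
pose u : R * R := (q.1 - p.1, q.2 - p.2).
have u_gt0 : 0 < dot2 u u.
  rewrite /dot2 -!expr2 lt_def addr_ge0 ?sqr_ge0 // andbT paddr_eq0 ?sqr_ge0 //.
  rewrite !sqrf_eq0 /= !subr_eq0; apply: contra_notN Kq => /andP[/eqP e1 /eqP e2].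
  by rewrite [q]surjective_pairing e1 e2 -surjective_pairing.
exists u; have [z Kz [-> _]] := suppP u HK.
have zp : dot2 u z <= dot2 u p.
  rewrite leNgt; apply/negP => lt.
  pose d := dot2 u z - dot2 u p.
  have d0 : 0 < d by rewrite subr_gt0.
  pose N := (z.1 - p.1) ^+ 2 + (z.2 - p.2) ^+ 2.
  have N0 : 0 <= N by rewrite addr_ge0 ?sqr_ge0.
  (* Moving from [p] towards [z] by [t] changes [f] by [t * (2 * d - t * N)], which is positive for
     this [t]; the 1 in [N + 1] keeps the denominator positive. *)
  pose t := Num.min 1 (d / (N + 1)).
  have N1 : 0 < N + 1 by rewrite ltr_wpDl.
  have t0 : 0 < t by rewrite lt_min ltr01 divr_gt0.
  have t1 : t <= 1 by rewrite ge_min lexx.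
  have tN : t * (N + 1) <= d by rewrite -ler_pdivlMr // ge_min lexx orbT.
  have t01 : 0 <= t <= 1 by rewrite t1 ltW.
  have := pmax _ (vK z p Kz Kp t t01).
  suff : f p < f (t * z.1 + (1 - t) * p.1, t * z.2 + (1 - t) * p.2) by move=> /lt_le_trans h /h; rewrite ltxx.
  rewrite -subr_gt0.
  have -> : f (t * z.1 + (1 - t) * p.1, t * z.2 + (1 - t) * p.2) - f p
    = t * (2 * d - t * N) by rewrite /f /d /N /dot2 /u /=; ring.
  rewrite mulr_gt0 //; have := tN; rewrite mulrDr mulr1; lra.
apply: le_lt_trans zp _; rewrite -subr_gt0.
by have -> : dot2 u q - dot2 u p = dot2 u u by rewrite /dot2 /u /=; ring.
Qed.

End Support.

Section Approximation.
Variable R : realType.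
Implicit Types (K L M N : set (R * R)) (u z : R * R).

(* Slopes of spacing [2^-m] covering [[-2^m, 2^m]]: nested as [m] grows. *)
Definition grid (m k : nat) : R := - 2 ^+ m + k%:R / 2 ^+ m.
Definition grid_size (m : nat) : nat := (2 * 4 ^ m)%N.

Lemma grid_lt m k : grid m k < grid m k.+1.
Proof. by rewrite ltrD2l ltr_pM2r ?invr_gt0 ?exprn_gt0 // ltr_nat. Qed.

(** The finer grid starts further left by 2^m, which is [2 * 4 ^ m] of its steps, and its steps are
    half as long. *)
Lemma grid_refine m k : grid m k = grid m.+1 (2 * 4 ^ m + 2 * k).
Proof.
have E : ((4 ^ m)%:R : R) = 2 ^+ m * 2 ^+ m.
  by rewrite -exprMn natrX; congr (_ ^+ _); rewrite -natrM.
rewrite /grid natrD !natrM E exprS.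
have p : (2 : R) ^+ m != 0 by rewrite expf_neq0.
by field.
Qed.

Definition approx m (h : R * R -> R) := polygon (grid m) (grid_size m) h.

Lemma approx_nested h : nonincreasing_seq (fun m => approx m h).
Proof.
apply/nonincreasing_seqP => m; rewrite subsetEset => z [xz Kz]; split=> // k kn.
rewrite /upper /lower grid_refine; apply: (Kz (2 * 4 ^ m + 2 * k)%N).
by move: kn; rewrite /grid_size expnS; lia.
Qed.

Lemma sub_approx K m : convex_body2 K -> K `<=` approx m (supp K).
Proof.
move=> HK z Kz; have B u : dot2 u z <= supp K u by have [_ _ [_]] := suppP u HK; apply.
split.
  have := B (1, 0); have := B (-1, 0); rewrite /dot2 /xmin /xmax /=.
  by move=> h1 h2; apply/andP; split; lra.
move=> k _; have := B (- grid m k, 1); have := B (- grid m k, -1).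
by rewrite /upper /lower /dot2 /= => h1 h2; split; lra.
Qed.

Lemma grid_dense (x e : R) : 0 < e -> exists m k,
  (k <= grid_size m)%N /\ 0 <= x - grid m k < e.
Proof.
(* Since 2^n >= n, this level reaches beyond [x] on both sides and has spacing below [e]. *)
move=> e0; pose n := (Num.truncn (`|x| + e^-1)).+1.
have nlt : `|x| + e^-1 < n%:R.
  have e' : 0 <= `|x| + e^-1 by rewrite addr_ge0 // invr_ge0 ltW.
  by have /andP[] := truncn_itv e'.
have n2 : n%:R <= (2 : R) ^+ n by rewrite -natrX ler_nat ltnW // ltn_expl.
have p0 : 0 < (2 : R) ^+ n by rewrite exprn_gt0.
have xn : `|x| < 2 ^+ n.
  apply: lt_le_trans n2; apply: le_lt_trans nlt.
  by rewrite lerDl ltW // invr_gt0.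
have y0 : 0 <= (x + 2 ^+ n) * 2 ^+ n.
  by rewrite mulr_ge0 ?ltW //; move: xn; rewrite ltr_norml => /andP[? _]; lra.
have /andP[k1 k2] := truncn_itv y0; set k := Num.truncn _ in k1 k2.
exists n, k; split.
  rewrite -(ler_nat R); apply: le_trans k1 _.
  rewrite /grid_size natrM natrX -[4%:R]/(2 * 2)%:R natrM exprMn.
  have : x + 2 ^+ n <= 2 * 2 ^+ n by move: xn; rewrite ltr_norml => /andP[_ ?]; lra.
  by rewrite mulrA => ?; rewrite ler_wpM2r // ltW.
have -> : x - grid n k = (x + 2 ^+ n) - k%:R / 2 ^+ n by rewrite /grid; ring.
rewrite subr_ge0 ler_pdivrMr // k1 /=.
rewrite ltrBlDr -(ltr_pM2r p0) [X in _ < X]mulrDl divfK ?gt_eqF //.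
apply: lt_le_trans k2 _; rewrite -natr1 addrC lerD2r.
rewrite -ler_pdivrMl //; rewrite mulr1.
by apply: le_trans n2; apply: ltW; apply: le_lt_trans nlt; rewrite lerDr.
Qed.

Lemma bigcap_approx K : convex_body2 K -> \bigcap_m approx m (supp K) = K.
Proof.
move=> HK; apply/seteqP; split; last by move=> z Kz m _; exact: sub_approx.
move=> q Aq; apply: contrapT => /(separation HK)[u uq].
have hS := sublinear_supp HK.
have [xq _] := Aq 0%N I.
have [u20|u20] := eqVneq u.2 0.
  move: uq xq; rewrite [u]surjective_pairing u20 /dot2 /= mul0r addr0.
  have [u1|u1] := leP 0 u.1.
    have := sublinearZ hS 1 0 u1; rewrite mulr1 mulr0 => -> uq /andP[_].
    by have := ler_wpM2l u1 (_ : q.1 <= xmax (supp K)); rewrite /xmax => h /h; lra.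
  have u1' : 0 <= - u.1 by rewrite oppr_ge0 ltW.
  have := sublinearZ hS (-1) 0 u1'; rewrite mulrN1 opprK mulr0 => -> uq /andP[h _].
  by have := ler_wpM2l u1' h; rewrite /xmin; lra.
pose e : R := u.2 / `|u.2|.
have au : 0 < `|u.2| by rewrite normr_gt0.
pose x := - u.1 / `|u.2|.
pose d := (dot2 u q - supp K u) / `|u.2|.
have d0 : 0 < d by rewrite divr_gt0 ?subr_gt0.
have gap : supp K (- x, e) + d = - x * q.1 + e * q.2.
  have := sublinearZ hS (- x) e (ltW au).
  have -> : `|u.2| * - x = u.1 by rewrite /x; field; rewrite gt_eqF.
  have -> : `|u.2| * e = u.2 by rewrite /e; field; rewrite gt_eqF.
  rewrite -surjective_pairing => E; rewrite /d E /x /e /dot2.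
  by field; rewrite gt_eqF.
(* Replacing the slope [x] by a grid slope below it adds a multiple of (1, 0) to the normal. This
   costs at most [C] times the difference of the slopes, which must stay below the gap [d]. *)
pose C := `|q.1| + `|supp K (1, 0)| + 1.
have C0 : 0 < C by rewrite ltr_wpDl ?addr_ge0.
have [m [k [km /andP[xk0 xk]]]] := grid_dense x (divr_gt0 d0 C0).
have [_ /(_ k km)] := Aq m I; rewrite /upper /lower.
have bound : supp K (- grid m k, e) <= supp K (- x, e) + (x - grid m k) * supp K (1, 0).
  have := sublinearD hS (- x) e ((x - grid m k) * 1) ((x - grid m k) * 0).
  rewrite sublinearZ // mulr1 mulr0 addr0.
  by have -> : - x + (x - grid m k) = - grid m k by ring.
have small : (x - grid m k) * C < d by rewrite -ltr_pdivlMr.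
have s1 : (x - grid m k) * supp K (1, 0) <= (x - grid m k) * `|supp K (1, 0)|.
  by rewrite ler_wpM2l // ler_norm.
have s2 : - ((x - grid m k) * q.1) <= (x - grid m k) * `|q.1|.
  by rewrite -mulrN ler_wpM2l // -normrN ler_norm.
have contra : - grid m k * q.1 + e * q.2 <= supp K (- grid m k, e) -> False.
  move: small; rewrite /C !mulrDr mulr1; lra.
have [e1|e1] : e = 1 \/ e = -1.
  have [u2|u2] := ltP 0 u.2; [left|right]; rewrite /e.
    by rewrite gtr0_norm // divff.
  by rewrite ler0_norm // invrN mulrN divff.
- by move=> [h _]; apply: contra; rewrite e1; lra.
- by move=> [_ h]; apply: contra; rewrite e1; lra.
Qed.

End Approximation.

(** * Passage to the limit: mixed areas of convex bodies *)

Section MixedArea.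
Variable R : realType.
Implicit Types (K L M N : set (R * R)) (u z : R * R).

Notation mu := (@lebesgue_measure R).

Definition approx_form m (h g : R * R -> R) : R :=
  polygon_form (grid R m) (grid_size m) h g.

Lemma area_approx K m : convex_body2 K ->
  area (approx m (supp K)) = (approx_form m (supp K) (supp K) / 4)%:E.
Proof.
by move=> HK; apply: area_polygon_form; [exact: grid_lt | exact: sublinear_supp].
Qed.

Lemma measurable_approx K m : convex_body2 K -> measurable (approx m (supp K)).
Proof.
by move=> HK; apply: measurable_polygon; exact: sublinear_supp.
Qed.

Lemma measurable_body K : convex_body2 K -> measurable K.
Proof.
move=> HK; rewrite -(bigcap_approx HK); apply: bigcapT_measurable => m.
exact: measurable_approx.
Qed.

Lemma area_fin_num K : convex_body2 K -> area K \is a fin_num.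
Proof.
move=> HK; rewrite ge0_fin_numE; last exact: (measure_ge0 (mu \x mu)%E).
apply: le_lt_trans (_ : area (approx 0 (supp K)) < +oo)%E.
  apply: (le_measure (mu \x mu)%E); rewrite ?inE.
  - exact: measurable_body.
  - exact: measurable_approx.
  - exact: sub_approx.
by rewrite area_approx // ltry.
Qed.

Lemma approx_form_cvg K : convex_body2 K ->
  (fun m => approx_form m (supp K) (supp K) / 4) @ \oo --> fine (area K).
Proof.
move=> HK.
have -> : (fun m => approx_form m (supp K) (supp K) / 4)
    = fine \o (fun m => area (approx m (supp K))).
  by apply/funext => m; exact: esym (congr1 fine (area_approx m HK)).
apply: fine_cvg; rewrite fineK ?area_fin_num // -[in X in _ --> X](bigcap_approx HK).
apply: (@nonincreasing_cvg_mu _ _ _ (mu \x mu)%E) => //.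
- suff h : (area (approx 0 (supp K)) < +oo)%E by exact: h.
  by rewrite area_approx // ltry.
- by move=> m; exact: measurable_approx.
- by apply: bigcapT_measurable => m; exact: measurable_approx.
- exact: approx_nested.
Qed.

Lemma mixed_area_cvg K L : convex_body2 K -> convex_body2 L ->
  (fun m => approx_form m (supp K) (supp L) / 4) @ \oo --> mixed_area K L.
Proof.
move=> HK HL; have HS := convex_body_msum HK HL.
have E m : approx_form m (supp K) (supp L) / 4 =
    (approx_form m (supp (msum K L)) (supp (msum K L)) / 4
     - approx_form m (supp K) (supp K) / 4
     - approx_form m (supp L) (supp L) / 4) / 2.
  by rewrite supp_msum // /approx_form polygon_formD; field.
under eq_fun do rewrite E.
apply: cvgMr_tmp; apply: cvgB; last exact: approx_form_cvg.
by apply: cvgB; exact: approx_form_cvg.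
Qed.

Lemma approx_form_plucker m K L M N : convex_body2 K -> convex_body2 L ->
  convex_body2 M -> convex_body2 N ->
  approx_form m (supp K) (supp L) * approx_form m (supp M) (supp N) <=
  approx_form m (supp K) (supp M) * approx_form m (supp L) (supp N)
  + approx_form m (supp K) (supp N) * approx_form m (supp L) (supp M).
Proof.
move=> HK HL HM HN; rewrite /approx_form.
have sS X (HX : convex_body2 X) := sublinear_supp HX.
have lt := @grid_lt R m.
rewrite -!(vsum_polygon_edges (grid_size m) lt); try exact: sublinear_supp.
apply: plucker_edges; try by apply: closed_polygon_edges => //; exact: sublinear_supp.
by rewrite xpair_eqE oppr_eq0 oner_eq0 andbF.
Qed.

Lemma approx_form_ge0 m K L : convex_body2 K -> convex_body2 L ->
  0 <= approx_form m (supp K) (supp L).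
Proof.
move=> HK HL; rewrite /approx_form -(vsum_polygon_edges (grid_size m) (@grid_lt R m));
  try exact: sublinear_supp.
apply: sumr_ge0 => a _; apply: sumr_ge0 => b _.
by rewrite /half_kernel; case: ifP.
Qed.

Lemma mixed_area_ge0 K L : convex_body2 K -> convex_body2 L -> 0 <= mixed_area K L.
Proof.
move=> HK HL; apply: (cvgr_to_ge (mixed_area_cvg HK HL)).
by apply: nearW => m; rewrite divr_ge0 // approx_form_ge0.
Qed.

Lemma mixed_area_plucker K L M N : convex_body2 K -> convex_body2 L ->
  convex_body2 M -> convex_body2 N ->
  mixed_area K L * mixed_area M N <=
  mixed_area K M * mixed_area L N + mixed_area K N * mixed_area L M.
Proof.
move=> HK HL HM HN.
apply: (ler_cvg_to (cvgM (mixed_area_cvg HK HL) (mixed_area_cvg HM HN))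
  (cvgD (cvgM (mixed_area_cvg HK HM) (mixed_area_cvg HL HN))
        (cvgM (mixed_area_cvg HK HN) (mixed_area_cvg HL HM)))).
apply: nearW => m; have := approx_form_plucker m HK HL HM HN.
rewrite /= !fctE /=; lra.
Qed.

(** The support function of the sum is twice that of [K], and the approximating forms are quadratic
    in it. *)
Lemma area_double K : convex_body2 K -> fine (area (msum K K)) = 4 * fine (area K).
Proof.
move=> HK; have HS := convex_body_msum HK HK.
have E m : approx_form m (supp (msum K K)) (supp (msum K K)) / 4
    = 4 * (approx_form m (supp K) (supp K) / 4).
  by rewrite supp_msum // /approx_form polygon_formD; field.
have C : (fun m => approx_form m (supp (msum K K)) (supp (msum K K)) / 4) @ \oo
    --> 4 * fine (area K).
  by under eq_fun do rewrite E; apply: cvgMl_tmp; exact: approx_form_cvg.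
exact: (cvg_unique _ (approx_form_cvg HS) C).
Qed.

Lemma mixed_area_self K : convex_body2 K -> mixed_area K K = fine (area K).
Proof.
move=> HK; rewrite /mixed_area area_double //; move: (fine _) => a.
by field.
Qed.

End MixedArea.

(** * Bodies of zero area *)

Section Parallelogram.
Variable R : realType.
Implicit Types (K L M N : set (R * R)) (d e z : R * R).

Notation mu := (@lebesgue_measure R).

Lemma lebesgue_measure_translate (t : R) (A : set R) : measurable A ->
  mu ((fun x => x + t) @^-1` A) = mu A.
Proof.
move=> mA.
have mt : measurable_fun setT ((fun x => x + t) : R -> measurableTypeR R).
  by apply: measurable_funD.
suff : mu A = pushforward mu ((fun x => x + t) : _ -> measurableTypeR R) A.
  by move=> ->.
apply: lebesgue_measure_unique => //= _ [[a b]] _ <-.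
rewrite /pushforward.
have -> : (fun x => x + t) @^-1` `]a, b]%classic = `]a - t, b - t]%classic.
  by apply/seteqP; split=> x /=; rewrite !in_itv /= ltrBlDr lerBrDr.
rewrite !lebesgue_measure_itv /= !lte_fin ltrD2r.
by case: ifP => // _; rewrite -!EFinB; congr EFin; ring.
Qed.

Lemma lebesgue_measure_strip (p q a k : R) : p <= q -> k != 0 ->
  mu [set x | p <= a + k * x <= q] = ((q - p) / `|k|)%:E.
Proof.
move=> pq k0.
have itv (x y : R) : x <= y -> mu `[x, y]%classic = (y - x)%:E.
  rewrite le_eqVlt lebesgue_measure_itv /= lte_fin => /orP[/eqP->|->] //.
  by rewrite ltxx subrr.
have [kp|kn|/eqP] := ltgtP k 0; last by rewrite (negbTE k0).
- have -> : [set x | p <= a + k * x <= q] = `[(q - a) / k, (p - a) / k]%classic.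
    apply/seteqP; split=> x /=; rewrite in_itv /= ler_ndivrMr // ler_ndivlMr //;
    by move=> /andP[h1 h2]; apply/andP; split; lra.
  rewrite itv ?ler_nM2r ?invr_lt0 ?lerD2r // ltr0_norm //.
  by congr EFin; field.
- have -> : [set x | p <= a + k * x <= q] = `[(p - a) / k, (q - a) / k]%classic.
    apply/seteqP; split=> x /=; rewrite in_itv /= ler_pdivrMr // ler_pdivlMr //;
    by move=> /andP[h1 h2]; apply/andP; split; lra.
  rewrite itv ?ler_pM2r ?invr_gt0 ?lerD2r // gtr0_norm //.
  by congr EFin; field.
Qed.

Definition strips d e (p q p' q' : R) : set (R * R) :=
  [set z | p <= det2 d z <= q /\ p' <= det2 e z <= q'].

Lemma measurable_linear_strip (a b p q : R) :
  measurable [set z : R * R | p <= a * z.2 + b * z.1 <= q].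
Proof.
have -> : [set z : R * R | p <= a * z.2 + b * z.1 <= q]
   = (fun z : R * R => a * z.2 + b * z.1) @^-1` `[p, q]%classic.
  by apply/seteqP; split=> z /=; rewrite in_itv.
have mf : measurable_fun setT (fun z : R * R => a * z.2 + b * z.1).
  have ms : measurable_fun setT (fun z : R * R => z.2) by exact: measurable_snd.
  have mf : measurable_fun setT (fun z : R * R => z.1) by exact: measurable_fst.
  apply: measurable_funD; [exact: (measurable_funM (measurable_cst a) ms) |
    exact: (measurable_funM (measurable_cst b) mf)].
by rewrite -[X in measurable X]setTI; exact: mf.
Qed.

Lemma measurable_strips d e p q p' q' : measurable (strips d e p q p' q').
Proof.
have -> : strips d e p q p' q' = [set z : R * R | p <= d.1 * z.2 + (- d.2) * z.1 <= q]
   `&` [set z : R * R | p' <= e.1 * z.2 + (- e.2) * z.1 <= q'].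
  by apply/seteqP; split=> z /=; rewrite /strips /det2 /= !mulNr.
by apply: measurableI; exact: measurable_linear_strip.
Qed.

Lemma area_strips d e p q p' q' : det2 d e != 0 -> p <= q -> p' <= q' ->
  area (strips d e p q p' q') = ((q - p) * (q' - p') / `|det2 d e|)%:E.
Proof.
wlog d1 : d e p q p' q' / d.1 != 0.
  move=> W D pq pq'; have [d10|d10] := eqVneq d.1 0; last exact: W.
  have -> : strips d e p q p' q' = strips e d p' q' p q.
    by apply/seteqP; split=> z [].
  have D' : det2 e d = - det2 d e by rewrite /det2; ring.
  rewrite W // ?D' ?oppr_eq0 // ?normrN; first by congr (_ / _)%:E; ring.
  by apply: contraNneq D => e10; rewrite /det2 d10 e10 mul0r mulr0 subrr.
move=> D pq pq'; set k := det2 d e / d.1.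
have k0 : k != 0 by rewrite mulf_neq0 // invr_eq0.
pose Q : set (R * R) := [set z | p <= 0 + d.1 * z.2 <= q /\ p' <= e.1 * z.2 + (- k) * z.1 <= q'].
have mQ : measurable Q.
  have -> : Q = [set z : R * R | p <= d.1 * z.2 + 0 * z.1 <= q]
     `&` [set z : R * R | p' <= e.1 * z.2 + (- k) * z.1 <= q'].
    by apply/seteqP; split=> z /=; rewrite /Q /= mul0r add0r addr0.
  by apply: measurableI; exact: measurable_linear_strip.
(* The shear [y |-> y - (d.2 / d.1) x] preserves area slice by slice. *)
have -> : area (strips d e p q p' q') = area Q.
  rewrite /area /product_measure1; apply: eq_integral => x _ /=.
  rewrite -(@lebesgue_measure_translate (- (d.2 / d.1 * x)) (xsection Q x));
    last exact: measurable_xsection.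
  congr (mu _); apply/seteqP; split=> y; rewrite /xsection /= !inE /strips /Q /=;
  have -> : det2 d (x, y) = 0 + d.1 * (y - d.2 / d.1 * x) by rewrite /det2 /=; field.
    have -> // : det2 e (x, y) = e.1 * (y - d.2 / d.1 * x) + - k * x.
    by rewrite /k /det2 /=; field.
  have -> // : det2 e (x, y) = e.1 * (y - d.2 / d.1 * x) + - k * x.
  by rewrite /k /det2 /=; field.
(* The first strip is now horizontal. Integrating in the other order, the sections at heights inside
   it all have the same length, by [lebesgue_measure_strip]. *)
have -> : area Q = (\int[mu]_y mu (ysection Q y))%E.
  transitivity ((mu \x^ mu)%E Q) => //; rewrite /area.
  by apply: product_measure_unique => //= A B mA mB; rewrite product_measure2E.
have -> : (\int[mu]_y mu (ysection Q y))%E = (\int[mu]_y (((q' - p') / `|k|)%:E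
   * (\1_[set y | p <= 0 + d.1 * y <= q] y)%:E))%E.
  apply: eq_integral => y _; rewrite indicE.
  have [/set_mem yT|yT] := boolP (y \in _).
    rewrite mule1 -[`|k|]normrN -(@lebesgue_measure_strip p' q' (e.1 * y)) ?oppr_eq0 //.
    congr (mu _); apply/seteqP; split=> x; rewrite /ysection /= inE /Q /=.
      by case.
    by [].
  rewrite mule0 -[RHS](measure0 mu); congr (mu _); apply/seteqP; split=> x //.
  rewrite /ysection /= inE /Q /= => -[h _]; move/negP: yT; apply.
  by rewrite inE.
have mT : measurable [set y : R | p <= 0 + d.1 * y <= q].
  have -> : [set y : R | p <= 0 + d.1 * y <= q] = (fun y => 0 + d.1 * y) @^-1` `[p, q]%classic.
    by apply/seteqP; split=> z /=; rewrite in_itv.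
  have mf : measurable_fun setT (fun y : R => 0 + d.1 * y).
    by apply: continuous_measurable_fun; exact: continuous_affine.
  by rewrite -[X in measurable X]setTI; apply: mf; [exact: measurableT | exact: measurable_itv].
rewrite ge0_integralZl //; last 2 first.
- by apply/measurable_EFinP; exact: measurable_indic.
- by rewrite lee_fin divr_ge0 // subr_ge0.
rewrite integral_indic // setIT.
transitivity (((q' - p') / `|k|)%:E * ((q - p) / `|d.1|)%:E)%E.
  by congr (_ * _)%E; exact: lebesgue_measure_strip.
rewrite -EFinM; congr EFin; rewrite /k normrM normfV; field.
by rewrite !normr_eq0 D d1.
Qed.

End Parallelogram.

Section Segments.
Variable R : realType.
Implicit Types (K L M N : set (R * R)) (p q d e z : R * R).

Notation mu := (@lebesgue_measure R).

Definition segment p d : set (R * R) :=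
  [set z | exists2 s, 0 <= s <= 1 & z = (p.1 + s * d.1, p.2 + s * d.2)].

Definition parallelogram p d e (r : R) : set (R * R) :=
  [set z | exists s t, [/\ 0 <= s <= r, 0 <= t <= r &
    z = (p.1 + s * d.1 + t * e.1, p.2 + s * d.2 + t * e.2)]].

Lemma msum_segment p d q e : msum (segment p d) (segment q e) =
  parallelogram (p.1 + q.1, p.2 + q.2) d e 1.
Proof.
apply/seteqP; split=> z.
  move=> [_ [s s01 ->] [_ [t t01 ->] ->]]; exists s, t; split=> //=.
  by congr pair; ring.
move=> [s [t [s01 t01 ->]]]; exists (p.1 + s * d.1, p.2 + s * d.2); first by exists s.
exists (q.1 + t * e.1, q.2 + t * e.2); first by exists t.
by congr pair => /=; ring.
Qed.

Lemma parallelogram_strips p d e r : det2 d e != 0 -> exists a b,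
  parallelogram p d e r =
  strips d e a (a + r * `|det2 d e|) b (b + r * `|det2 d e|).
Proof.
move=> D.
have dz s t : det2 d (p.1 + s * d.1 + t * e.1, p.2 + s * d.2 + t * e.2)
   = det2 d p + t * det2 d e by rewrite /det2 /=; ring.
have ez s t : det2 e (p.1 + s * d.1 + t * e.1, p.2 + s * d.2 + t * e.2)
   = det2 e p - s * det2 d e by rewrite /det2 /=; ring.
have cramer z : z = (p.1 + (det2 e p - det2 e z) / det2 d e * d.1
      + (det2 d z - det2 d p) / det2 d e * e.1,
    p.2 + (det2 e p - det2 e z) / det2 d e * d.2
      + (det2 d z - det2 d p) / det2 d e * e.2).
  move: D; rewrite /det2; case: z => x y /= D.
  by congr pair; field; rewrite D.
have [Dp|Dn|/eqP] := ltgtP (det2 d e) 0; last by rewrite (negbTE D).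
- exists (det2 d p + r * det2 d e), (det2 e p).
  rewrite ltr0_norm //; apply/seteqP; split=> z.
    move=> [s [t [/andP[s0 s1] /andP[t0 t1] ->]]]; rewrite /strips /= dz ez.
    by split; apply/andP; split; nra.
  move=> [/andP[h1 h2] /andP[h3 h4]].
  exists ((det2 e p - det2 e z) / det2 d e), ((det2 d z - det2 d p) / det2 d e).
  split; [| | exact: cramer];
  by rewrite ler_ndivlMr // ler_ndivrMr //; apply/andP; split; lra.
- exists (det2 d p), (det2 e p - r * det2 d e).
  rewrite gtr0_norm //; apply/seteqP; split=> z.
    move=> [s [t [/andP[s0 s1] /andP[t0 t1] ->]]]; rewrite /strips /= dz ez.
    by split; apply/andP; split; nra.
  move=> [/andP[h1 h2] /andP[h3 h4]].
  exists ((det2 e p - det2 e z) / det2 d e), ((det2 d z - det2 d p) / det2 d e).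
  split; [| | exact: cramer];
  by rewrite ler_pdivlMr // ler_pdivrMr //; apply/andP; split; lra.
Qed.

Lemma area_parallelogram p d e r : 0 <= r -> det2 d e != 0 ->
  area (parallelogram p d e r) = (r ^+ 2 * `|det2 d e|)%:E.
Proof.
move=> r0 D; have [a [b ->]] := parallelogram_strips p r D.
have rD : 0 <= r * `|det2 d e| by rewrite mulr_ge0.
rewrite area_strips ?lerDl //; congr EFin; field.
by rewrite normr_eq0.
Qed.

(** The set lies on a line parallel to some nonzero [v], hence in a strip of width zero; the
    perpendicular [w] bounds it along the line. *)
Lemma area_parallelogram0 p d e : measurable (parallelogram p d e 1) ->
  det2 d e = 0 ->
  area (parallelogram p d e 1) = 0%E.
Proof.
move=> mP D.
have [v v0 [vd ve]] : exists2 v : R * R, v != (0, 0) & det2 v d = 0 /\ det2 v e = 0.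
  have self x : det2 x x = 0 by rewrite /det2; ring.
  have [d0|d0] := eqVneq d (0, 0); last by exists d.
  have [e0|e0] := eqVneq e (0, 0).
    exists (1, 0); first by rewrite xpair_eqE oner_eq0.
    by rewrite d0 e0 /det2 /= !mulr0 subrr.
  by exists e; rewrite // self d0 /det2 /= !mulr0 subrr.
pose w : R * R := (- v.2, v.1).
have vw : det2 v w != 0.
  rewrite /det2 /= mulrN opprK -!expr2 paddr_eq0 ?sqr_ge0 // !sqrf_eq0.
  by rewrite -xpair_eqE -surjective_pairing.
pose C := `|det2 w d| + `|det2 w e|.
have C0 : 0 <= C by rewrite addr_ge0.
have sub : parallelogram p d e 1 `<=`
    strips v w (det2 v p) (det2 v p) (det2 w p - C) (det2 w p + C).
  move=> z [s [t [/andP[s0 s1] /andP[t0 t1] ->]]].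
  have lin u : det2 u (p.1 + s * d.1 + t * e.1, p.2 + s * d.2 + t * e.2)
    = det2 u p + s * det2 u d + t * det2 u e by rewrite /det2 /=; ring.
  rewrite /strips /= !lin vd ve !mulr0 !addr0 lexx; split=> //.
  have bnd (x y : R) : 0 <= x -> x <= 1 -> - `|y| <= x * y <= `|y|.
    move=> x0 x1; rewrite -ler_norml normrM (ger0_norm x0).
    by rewrite ler_piMl.
  have /andP[? ?] := bnd s (det2 w d) s0 s1; have /andP[? ?] := bnd t (det2 w e) t0 t1.
  by apply/andP; split; rewrite /C; lra.
have mS := @measurable_strips R v w (det2 v p) (det2 v p) (det2 w p - C) (det2 w p + C).
have S0 : area (strips v w (det2 v p) (det2 v p) (det2 w p - C) (det2 w p + C)) = 0%E.
  rewrite area_strips //; last by lra.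
  by rewrite subrr !mul0r.
apply/eqP; rewrite eq_le; apply/andP; split.
  by rewrite -S0; apply: (le_measure (mu \x mu)%E); rewrite ?inE.
exact: (measure_ge0 (mu \x mu)%E).
Qed.

Lemma zero_area_collinear K p q r : convex_body2 K -> area K = 0%E ->
  K p -> K q -> K r -> det2 (q.1 - p.1, q.2 - p.2) (r.1 - p.1, r.2 - p.2) = 0.
Proof.
move=> HK K0 Kp Kq Kr; apply/eqP; apply: contraT => D.
have [_ [_ vK]] := HK.
(* With half sides, every point is the midpoint of a point on the segment from [p] to [q] and one on
   the segment from [p] to [r]. *)
have sub : parallelogram p (q.1 - p.1, q.2 - p.2) (r.1 - p.1, r.2 - p.2) (1 / 2) `<=` K.
  move=> z [s [t [/andP[s0 s1] /andP[t0 t1] ->]]].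
  have s2 : 0 <= 2 * s <= 1 by apply/andP; split; lra.
  have t2 : 0 <= 2 * t <= 1 by apply/andP; split; lra.
  have half : 0 <= (1 / 2 : R) <= 1 by apply/andP; split; lra.
  have := vK _ _ (vK q p Kq Kp _ s2) (vK r p Kr Kp _ t2) _ half.
  by congr (K (_, _)) => /=; field.
have h0 : 0 <= (1 / 2 : R) by rewrite divr_ge0.
have A := area_parallelogram p h0 D.
have mP : measurable (parallelogram p (q.1 - p.1, q.2 - p.2)
    (r.1 - p.1, r.2 - p.2) (1 / 2)).
  by have [a [b ->]] := parallelogram_strips p (1 / 2) D; exact: measurable_strips.
set P := parallelogram _ _ _ _ in sub A mP.
have : (area P <= area K)%E.
  by apply: (le_measure (mu \x mu)%E); rewrite ?inE //; exact: measurable_body.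
rewrite A K0 lee_fin leNgt => /negP[].
by rewrite mulr_gt0 ?exprn_gt0 ?divr_gt0 // normr_gt0.
Qed.

Lemma zero_area_segment K : convex_body2 K -> area K = 0%E ->
  exists p d, K = segment p d.
Proof.
move=> HK K0; have [[c Kc] cvK] := HK; have [cK vK] := cvK.
have [other|only] := pselect (exists2 c', K c' & c' != c); last first.
  exists c, (0, 0); apply/seteqP; split=> z.
    move=> Kz; exists 0; rewrite ?lexx ?ler01 // !mul0r !addr0 -surjective_pairing.
    by apply: contrapT => /eqP zc; apply: only; exists z.
  by move=> [s _ ->]; rewrite /= !mulr0 !addr0 -surjective_pairing.
have [c' Kc' cc'] := other.
pose u : R * R := (c'.1 - c.1, c'.2 - c.2).
(* The ends of the segment are points where the linear form [u] is largest and smallest; they differ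
   because [u] separates [c] from [c']. *)
have [q Kq qmax] := compact_max (ex_intro _ c Kc) cK (@continuous_dot2 _ u).
have [p Kp pmax] := compact_max (ex_intro _ c Kc) cK (@continuous_dot2 _ (- u.1, - u.2)).
have pmin z : K z -> dot2 u p <= dot2 u z.
  by move=> /pmax; rewrite /dot2 /=; lra.
pose d : R * R := (q.1 - p.1, q.2 - p.2).
have ud : 0 < dot2 u d.
  have uu : 0 < dot2 u u.
    rewrite /dot2 -!expr2 lt_def addr_ge0 ?sqr_ge0 // andbT paddr_eq0 ?sqr_ge0 //.
    rewrite !sqrf_eq0 /= !subr_eq0; apply: contra cc' => /andP[/eqP e1 /eqP e2].
    by rewrite [c']surjective_pairing e1 e2 -surjective_pairing.
  apply: lt_le_trans uu _; have := qmax _ Kc'; have := pmin _ Kc.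
  by rewrite /dot2 /d /u /=; lra.
exists p, d; apply/seteqP; split=> z; last first.
  move=> [s s01 ->]; have := vK q p Kq Kp s s01.
  by congr (K (_, _)); rewrite /d /=; ring.
move=> Kz; pose s := dot2 u (z.1 - p.1, z.2 - p.2) / dot2 u d.
have col := zero_area_collinear HK K0 Kp Kq Kz.
exists s.
  apply/andP; split.
    rewrite divr_ge0 ?(ltW ud) //; have := pmin _ Kz.
    by rewrite /dot2 /=; lra.
  rewrite ler_pdivrMr // mul1r; have := qmax _ Kz.
  by rewrite /dot2 /d /=; lra.
have E1 : dot2 u (z.1 - p.1, z.2 - p.2) * d.1 - (z.1 - p.1) * dot2 u d
   = - u.2 * - det2 d (z.1 - p.1, z.2 - p.2) by rewrite /dot2 /det2 /=; ring.
have E2 : dot2 u (z.1 - p.1, z.2 - p.2) * d.2 - (z.2 - p.2) * dot2 u d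
   = u.1 * - det2 d (z.1 - p.1, z.2 - p.2) by rewrite /dot2 /det2 /=; ring.
rewrite col oppr0 mulr0 in E1; rewrite col oppr0 mulr0 in E2.
rewrite [LHS]surjective_pairing; congr pair; rewrite /s mulrAC.
  by rewrite (subr0_eq E1) mulfK ?gt_eqF // addrC subrK.
by rewrite (subr0_eq E2) mulfK ?gt_eqF // addrC subrK.
Qed.

Lemma mixed_area_segment p d q e :
  convex_body2 (segment p d) -> convex_body2 (segment q e) ->
  area (segment p d) = 0%E -> area (segment q e) = 0%E ->
  mixed_area (segment p d) (segment q e) = `|det2 d e| / 2.
Proof.
move=> HK HL Z Z'; have := measurable_body (convex_body_msum HK HL).
rewrite /mixed_area Z Z' msum_segment !subr0 => mP.
have [D|D] := eqVneq (det2 d e) 0.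
  by rewrite area_parallelogram0 // D normr0.
by rewrite area_parallelogram // expr1n mul1r.
Qed.

(** Up to signs, the Plucker relation would write x^2 as a difference of two copies of itself.
    Squaring removes the signs: with [Y] and [Z] the two products, 2 Y Z = x^4, although (Y Z)^2 =
    x^8. *)
Lemma four_dets (a b c d : R * R) (x : R) :
  `|det2 a b| = x -> `|det2 c d| = x -> `|det2 a c| = x -> `|det2 b d| = x ->
  `|det2 a d| = x -> `|det2 b c| = x -> x = 0.
Proof.
have sq (y : R) : `|y| = x -> y ^+ 2 = x ^+ 2 by move=> <-; rewrite real_normK ?num_real.
move=> /sq h1 /sq h2 /sq h3 /sq h4 /sq h5 /sq h6.
pose Y := det2 a c * det2 b d; pose Z := det2 a d * det2 b c.
have eX : (Y - Z) ^+ 2 = x ^+ 4.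
  by rewrite /Y /Z -det2_plucker exprMn h1 h2 -exprD.
have eY : Y ^+ 2 = x ^+ 4 by rewrite exprMn h3 h4 -exprD.
have eZ : Z ^+ 2 = x ^+ 4 by rewrite exprMn h5 h6 -exprD.
have YZ : 2 * (Y * Z) = x ^+ 4.
  by move: eX; rewrite sqrrB eY eZ -mulr_natl; lra.
have : (2 * (Y * Z)) ^+ 2 = 4 * (x ^+ 4 * x ^+ 4).
  by rewrite exprMn exprMn eY eZ -natrX.
rewrite YZ expr2 => h; have : x ^+ 4 * x ^+ 4 = 0 by lra.
by move=> /eqP; rewrite mulf_eq0 orbb expf_eq0 /= => /eqP.
Qed.

End Segments.

(** * A point of the Plucker space that no bodies realise *)

Section Counterexample.
Variable R : realType.

Definition paired_vec n (i j : 'I_n) : R :=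
  if [&& (i < 8)%N, (j < 8)%N & i./2 != j./2] then 1 else 0.

Lemma sym_paired_vec n : sym_vec (@paired_vec n).
Proof. by move=> i j; rewrite /paired_vec andbCA eq_sym. Qed.

Lemma paired_vec_ge0 n (i j : 'I_n) : 0 <= paired_vec i j.
Proof. by rewrite /paired_vec; case: ifP. Qed.

(** A nonzero left side is 1, with [i], [j] in different pairs and [k], [l] as well. If [i] shares a
    pair with [k], or [j] with [l], then neither [i] and [l] nor [j] and [k] do, so one product on
    the right is 1 in every case. *)
Lemma inPl_paired_vec n : inPl (@paired_vec n).
Proof.
split=> [i j _|i j k l _ _ _ _ _ _]; first exact: paired_vec_ge0.
have ge0 : 0 <= paired_vec i k * paired_vec j l + paired_vec i l * paired_vec j k.
  by rewrite addr_ge0 // mulr_ge0 ?paired_vec_ge0.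
rewrite {1}/paired_vec; case: ifP => [/and3P[i8 j8 ij]|_]; last by rewrite mul0r.
rewrite {1}/paired_vec; case: ifP => [/and3P[k8 l8 kl]|_]; last by rewrite mulr0.
rewrite /paired_vec i8 j8 k8 l8 /=.
have [ik|ik] := eqVneq i./2 k./2.
  have -> : (i./2 != l./2) by rewrite ik.
  have -> : (j./2 != k./2) by rewrite -ik eq_sym.
  by rewrite mul0r add0r.
have [jl|jl] := eqVneq j./2 l./2; last by rewrite mul1r lerDl mulr_ge0 //; case: ifP.
have -> : (i./2 != l./2) by rewrite -jl.
have -> : (j./2 != k./2) by rewrite jl eq_sym.
by rewrite mulr0 add0r.
Qed.

Lemma zero_area_of_twin (K L M : set (R * R)) : convex_body2 K -> convex_body2 L ->
  convex_body2 M -> mixed_area K L = 0 -> mixed_area L M = 1 -> area K = 0%E.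
Proof.
move=> HK HL HM KL LM; have := mixed_area_plucker HK HK HL HM.
rewrite KL LM mul0r mulr0 addr0 mulr1 mixed_area_self // => le0.
rewrite -(fineK (area_fin_num HK)); congr EFin; apply/eqP.
by rewrite eq_le le0 fine_ge0 //; exact: (measure_ge0 (_ \x _)%E).
Qed.

Lemma paired_vec_notin_PMV n : (8 <= n)%N -> ~ inPMV (@paired_vec n).
Proof.
move=> n8 [K [HK Kv]].
have lt (k : 'I_8) : (k < n)%N by exact: leq_trans (ltn_ord k) n8.
pose B (k : 'I_8) := K (Ordinal (lt k)).
have HB k : convex_body2 (B k) by exact: HK.
have BV (j k : 'I_8) : j != k -> mixed_area (B j) (B k) = if j./2 != k./2 then 1 else 0.
  by move=> jk; rewrite -Kv // /paired_vec /= !ltn_ord.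
have seg (j k l : 'I_8) : j != k -> k != l -> j./2 = k./2 -> k./2 != l./2 ->
    area (B j) = 0%E.
  move=> jk kl jk2 kl2; apply: (@zero_area_of_twin _ (B k) (B l)) => //.
    by rewrite BV // jk2 eqxx.
  by rewrite BV // kl2.
pose b (k : nat) := B (inord k).
have Z k : (k < 4)%N -> area (b k.*2) = 0%E.
  move=> k4; have k8 : (k.*2 < 8)%N by lia.
  have k8' : (k.*2.+1 < 8)%N by lia.
  (* The third index comes from the cyclically next pair, so its body has mixed area 1 with the
     twin. *)
  have l8 : ((k.*2 + 2) %% 8 < 8)%N by rewrite ltn_mod.
  apply: (@seg _ (inord k.*2.+1) (inord ((k.*2 + 2) %% 8))).
  - by rewrite -val_eqE /= !inordK //; lia.
  - by rewrite -val_eqE /= !inordK //; lia.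
  - by rewrite !inordK //; lia.
  - by rewrite !inordK //; lia.
have V j k : (j < 4)%N -> (k < 4)%N -> j != k -> mixed_area (b j.*2) (b k.*2) = 1.
  move=> j4 k4 jk; rewrite BV -?val_eqE /= !inordK //; try lia.
  by rewrite !doubleK jk.
have S k (k4 : (k < 4)%N) := zero_area_segment (HB (inord k.*2)) (Z k k4).
have [p0 [d0 e0]] := S 0%N isT; have [p1 [d1 e1]] := S 1%N isT.
have [p2 [d2 e2]] := S 2 isT; have [p3 [d3 e3]] := S 3 isT.
have D j k (pj dj pk dk : R * R) : (j < 4)%N -> (k < 4)%N -> j != k ->
    b j.*2 = segment pj dj -> b k.*2 = segment pk dk -> `|det2 dj dk| = 2.
  move=> j4 k4 jk ej ek; have := V j k j4 k4 jk.
  rewrite ej ek mixed_area_segment -?ej -?ek //; try exact: Z; try exact: HB.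
  lra.
have := four_dets (D 0%N 1%N _ _ _ _ isT isT isT e0 e1) (D 2 3 _ _ _ _ isT isT isT e2 e3)
  (D 0%N 2 _ _ _ _ isT isT isT e0 e2) (D 1%N 3 _ _ _ _ isT isT isT e1 e3)
  (D 0%N 3 _ _ _ _ isT isT isT e0 e3) (D 1%N 2 _ _ _ _ isT isT isT e1 e2).
by move/eqP; rewrite pnatr_eq0.
Qed.

End Counterexample.

Theorem mainTheorem4 (R : realType) :
  (forall n : nat, (4 <= n)%N ->
     forall v : 'I_n -> 'I_n -> R, sym_vec v -> inPMV v -> inPl v) /\
  (forall n : nat, (8 <= n)%N ->
     exists v : 'I_n -> 'I_n -> R, sym_vec v /\ inPl v /\ ~ inPMV v).
Proof.
split=> n n_ge.
  move=> v _ [K [HK Kv]]; split=> [i j ij|i j k l ij ik il jk jl kl].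
    by rewrite Kv //; exact: mixed_area_ge0.
  by rewrite !Kv //; exact: mixed_area_plucker.
exists (@paired_vec R n); split; first exact: sym_paired_vec.
by split; [exact: inPl_paired_vec | exact: paired_vec_notin_PMV].
Qed.
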